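(* Let $L$ be a non-degenerate integral lattice of rank $n$ with $\mathbb{Z}$-basis $B$, let $R$ and $S$ be disjoint subsets of $B$, and let $\lambda\in L^\circ$. The module $W(R,S;\lambda)$ decomposes as an $\mathrm{S}(\widehat{\mathfrak h}(S)_-)\otimes W(R)$-module into the form $$W(R,S;\lambda)\;\cong\;\mathrm{S}(\widehat{\mathfrak h}(S)_-)\otimes\bigoplus_{\delta\in L(S)}W(R;\delta+\lambda).$$
   Context: $L$ is a rank $n$ non-degenerate integral lattice with $\mathbb{Z}$-bilinear form $\langle\cdot,\cdot\rangle:L\times L\to\mathbb{Z}$, $B=\{\beta_1,\dots,\beta_n\}$ is a $\mathbb{Z}$-basis of $L$, and $L^\circ$ is the dual lattice of $L$. Put $\mathfrak h=\mathbb{C}\otimes_{\mathbb Z}L$, and let $\widehat{\mathfrak h}=\mathfrak h\otimes\mathbb{C}[t,t^{-1}]\oplus\mathbb{C}\mathbf{k}$ be the affine central extension. $M(1)=U(\widehat{\mathfrak h})\otimes_{U(\mathfrak h\otimes\mathbb{C}[t]\oplus\mathbb{C}\mathbf{k})}\mathbb{C}$ is its irreducible induced module, where $\mathfrak h\otimes\mathbb{C}[t]$ acts trivially and $\mathbf{k}$ acts as $1$ on the one-dimensional module $\mathbb{C}$. $M(1)$ is identified with the symmetric algebra $\mathrm{S}(\widehat{\mathfrak h}_-)$, where $\widehat{\mathfrak h}_-=\mathfrak h\otimes t^{-1}\mathbb{C}[t^{-1}]$; write $h_j$ for $h\otimes t^j$. $V_L\cong M(1)\otimes\mathbb{C}[L]$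 is the lattice vertex operator (super)algebra associated with $L$, and $V_{L^\circ}=M(1)\otimes\mathbb{C}[L^\circ]$ is a $V_L$-module. The vertex operators are given by $Y(e^\alpha,x)=\sum_{m\in\mathbb{Z}}(e^\alpha)_mx^{-m-1}=\exp\bigl(-\sum_{j<0}\frac{x^{-j}}{j}\alpha_j\bigr)\exp\bigl(-\sum_{j>0}\frac{x^{-j}}{j}\alpha_j\bigr)e_\alpha x^\alpha$, where $e_\alpha(h\otimes e^\beta)=\epsilon(\alpha,\beta)\,h\otimes e^{\alpha+\beta}$ with $\epsilon(\alpha,\beta)$ the usual non-zero cocycle factors of the lattice construction, and $x^\alpha(h\otimes e^\beta)=x^{\langle\alpha,\beta\rangle}h\otimes e^\beta$. Write $e^\beta$ for $1\otimes e^\beta$. For $B'\subset B$ set $L(B')=\bigoplus_{\beta\in B'}\mathbb{Z}\beta$, $\mathfrak h(B')=\mathbb{C}\otimes_{\mathbb Z}L(B')$ and $\widehat{\mathfrak h}(B')_-=\mathfrak h(B')\otimes t^{-1}\mathbb{C}[t^{-1}]$; $\mathrm{S}(\widehat{\mathfrak h}(B')_-)$ denotes the symmetric algebra of $\widehat{\mathfrak h}(B')_-$. For disjoint $R,S\subset B$, the intermediate vertex subalgebra $W(R,S)$ of $V_L$ is the smallest vertex subalgebra of $V_L$ containing $e^\rho$ ($\rho\in R$), $e^{\pm\sigma}$ and $\sigma_{-1}\otimes1$ ($\sigma\in S$). For $\lambda\in L^\circ$, the intermediate module $W(R,S;\lambda)=W(R,S)\cdot e^\lambda\subset V_{L^\circ}$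 is the cyclic $W(R,S)$-module generated by $e^\lambda$. Set $W(R)=W(R,\emptyset)$ and $W(R;\lambda)=W(R,\emptyset;\lambda)$. *)

(* Defs.v *)
From HB Require Import structures.
From mathcomp Require Import all_boot all_order all_algebra.
From mathcomp Require Import finmap monalg.
From mathcomp Require Import boolp classical_sets functions cardinality fsbigop.
From mathcomp Require Import reals.
From mathcomp Require Import complex.

Set Implicit Arguments.
Unset Strict Implicit.
Unset Printing Implicit Defensive.

Import GRing.Theory Num.Theory.
Local Open Scope classical_set_scope.
Local Open Scope ring_scope.

(* A lattice L with a chosen Z-basis beta_1, .., beta_n is given by its Gram  *)
(* matrix G; vectors of L, of Q (x) L and of C (x) L are row vectors of       *)
(* coordinates in that basis, with entries in int, rat and C respectively.    *)
Section Lattice.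
Variables (n : nat) (G : 'M[int]_n).

Definition bform (F : comNzRingType) (x y : 'rV[F]_n) : F :=
  (x *m map_mx intr G *m y^T) 0 0.

Definition nondegenerate_form :=
  forall x : 'rV[int]_n, (forall y : 'rV[int]_n, bform x y = 0) -> x = 0.

Definition dual_pred : {pred 'rV[rat]_n} :=
  fun x => `[< forall y : 'rV[int]_n, bform x (map_mx intr y) \is a Num.int >].

Lemma dual_zmod_closed : zmod_closed dual_pred.
Proof.
split=> [|x y /asboolP dx /asboolP dy]; apply/asboolP => z.
  by rewrite /bform !mul0mx mxE rpred0.
by rewrite /bform !mulmxBl mxE [X in _ + X]mxE rpredB ?dx ?dy.
Qed.

HB.instance Definition _ := GRing.isZmodClosed.Build 'rV[rat]_n dual_pred
  dual_zmod_closed.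

(* The dual lattice, inside Q (x) L. *)
Record dual := Dual { dual_val :> 'rV[rat]_n; _ : dual_val \in dual_pred }.

HB.instance Definition _ := [isSub for dual_val].
HB.instance Definition _ := [Choice of dual by <:].
HB.instance Definition _ := [SubChoice_isSubZmodule of dual by <:].

Lemma latt_subproof (a : 'rV[int]_n) : map_mx intr a \in dual_pred.
Proof.
apply/asboolP => y; rewrite /bform.
have -> : map_mx intr G = map_mx intr (map_mx intr G : 'M[int]_n) :> 'M[rat]_n.
  by apply/matrixP => i j; rewrite !mxE intz.
by rewrite map_trmx -!map_mxM mxE intr_int.
Qed.

(* The inclusion of L in its dual. *)
Definition latt (a : 'rV[int]_n) : dual := Dual (latt_subproof a).

Definition basis (i : 'I_n) : 'rV[int]_n := delta_mx 0 i.

(* The sublattice spanned by a subset of the basis. *)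
Definition sublattice (S : {set 'I_n}) : set 'rV[int]_n :=
  [set d | forall i, i \notin S -> d 0 i = 0].

End Lattice.

Section LinearAlgebra.
Variable K : fieldType.

Definition linext (I : choiceType) (X : lmodType K) (f : I -> X)
    (v : {malg K[I]}) : X :=
  \sum_(b <- msupp v) v@_b *: f b.

Definition subspace (X : lmodType K) (U : set X) :=
  U 0 /\ forall (c : K) u v, U u -> U v -> U (c *: u + v).

Definition lspan (X : lmodType K) (A : set X) : set X :=
  [set v | forall U, subspace U -> A `<=` U -> U v].

Definition linear_on (X Z : lmodType K) (U : set X) (f : X -> Z) :=
  forall (c : K) u v, U u -> U v -> f (c *: u + v) = c *: f u + f v.

Definition bilinear_on (P Q Z : lmodType K) (A : set P) (N : set Q)
    (f : P -> Q -> Z) :=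
  (forall p, A p -> linear_on N (f p)) /\
  (forall q, N q -> linear_on A (f^~ q)).

(* The bilinear map t exhibits the subspace T as the tensor product of the    *)
(* subspaces A and N.                                                         *)
Definition is_tensor (P Q X : lmodType K) (A : set P) (N : set Q) (T : set X)
    (t : P -> Q -> X) :=
  [/\ subspace A /\ subspace N, subspace T, bilinear_on A N t,
      forall p q, A p -> N q -> T (t p q)
    & forall (Z : lmodType K) (f : P -> Q -> Z), bilinear_on A N f ->
        exists phi : X -> Z,
        [/\ linear_on T phi,
            forall p q, A p -> N q -> phi (t p q) = f p q
          & forall psi : X -> Z, linear_on T psi ->
              (forall p q, A p -> N q -> psi (t p q) = f p q) ->
              forall x, T x -> psi x = phi x]].

Definition sumspace (I : Type) (X : lmodType K) (D : set I) (N : I -> set X) :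
    set X :=
  lspan (\bigcup_(i in D) N i).

Definition direct_sum (I : choiceType) (X : lmodType K) (D : set I)
    (N : I -> set X) :=
  forall (s : seq I) (w : I -> X), uniq s ->
    (forall i, i \in s -> D i /\ N i (w i)) ->
    \sum_(i <- s) w i = 0 -> forall i, i \in s -> w i = 0.

(* For a formal series a(x) = sum_(j >= 1) a_j x^j of operators, fpow a r k   *)
(* is the coefficient of x^k in a(x)^r and fexp a k that of exp(a(x)).        *)
Fixpoint fpow (X : lmodType K) (a : nat -> X -> X) (r k : nat) (v : X) : X :=
  if r is r'.+1 then \sum_(1 <= j < k.+1) a j (fpow a r' (k - j) v)
  else if k == 0%N then v else 0.

Definition fexp (X : lmodType K) (a : nat -> X -> X) (k : nat) (v : X) : X :=
  \sum_(r < k.+1) (r`!%:R)^-1 *: fpow a r k v.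

End LinearAlgebra.

(* The complex numbers over a model RR of the reals. *)
Definition CC (RR : realType) : fieldType := complex RR.

Section LatticeVertexAlgebra.
Variables (K : fieldType) (n : nat) (G : 'M[int]_n).

(* The variable (i, k) stands for beta_i (x) t^(-(k+1)). *)
Local Notation mon := {cmonom ('I_n * nat)%type}.

(* M(1) = S(h^_-). *)
Definition fock := {malg K[mon]}.

(* V_{L^o} = M(1) (x) C[L^o]; the basis vector indexed by (m, b) is           *)
(* m (x) e^b.                                                                 *)
Definition VLdual := {malg K[(mon * dual G)%type]}.
HB.instance Definition _ := GRing.Lmodule.on VLdual.
HB.instance Definition _ := GRing.Lmodule.on fock.

Definition bvec (m : mon) (b : dual G) : VLdual := << (m, b) >>.
Definition ee (b : dual G) : VLdual := bvec mone b.
Definition vac : VLdual := ee 0.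

Definition VL : set VLdual :=
  [set u | forall b, b \in msupp u -> exists a, b.2 = latt G a].

(* Multiplication by elements of S(h^_-) on the factor M(1). *)
Definition fmul (p : fock) (v : VLdual) : VLdual :=
  linext (fun m : mon => linext (fun b : mon * dual G => bvec (mmul m b.1) b.2) v) p.

Definition dvar (x : 'I_n * nat) (v : VLdual) : VLdual :=
  linext (fun b : mon * dual G => (b.1 x)%:R *: bvec (divcm b.1 (ucm x)) b.2) v.

Definition cvec (b : dual G) : 'rV[K]_n := map_mx ratr (dual_val b).
Definition cbasis (i : 'I_n) : 'rV[K]_n := delta_mx 0 i.

(* The operator h (x) t^j: multiplication for j < 0, a derivation on M(1) for *)
(* j > 0 determined by [h_j, h'_(-j)] = j <h, h'>, and <h, b> on e^b for      *)
(* j = 0.                                                                     *)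
Definition heis (h : 'rV[K]_n) (j : int) (v : VLdual) : VLdual :=
  match j with
  | Posz 0 => linext (fun b : mon * dual G => bform G h (cvec b.2) *: bvec b.1 b.2) v
  | Posz k.+1 =>
      \sum_(i < n) (k.+1%:R * bform G h (cbasis i)) *: dvar (i, k) v
  | Negz k => \sum_(i < n) h 0 i *: fmul << ucm (i, k) >> v
  end.

(* 2-cocycle factors for the lattice vertex superalgebra and its module       *)
(* V_{L^o}; only the values on L x L^o matter.                                *)
Definition cocycle (eps : dual G -> dual G -> K) :=
  [/\ forall a c, eps (latt G a) c != 0,
      forall c, eps 0 c = 1,
      forall a, eps (latt G a) 0 = 1,
      forall a b c,
        eps (latt G a) (latt G b) * eps (latt G (a + b)) c =
        eps (latt G b) c * eps (latt G a) (latt G b + c)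
    & forall a b,
        eps (latt G a) (latt G b) =
        (-1) ^ (bform G a b + bform G a a * bform G b b) *
          eps (latt G b) (latt G a)].

Variable eps : dual G -> dual G -> K.

(* The coefficients of x^k in exp(- sum_(j < 0) x^(-j) alpha_j / j), and of   *)
(* x^(-k) in exp(- sum_(j > 0) x^(-j) alpha_j / j).                           *)
Definition expcreate (al : dual G) : nat -> VLdual -> VLdual :=
  fexp (fun j v => (j%:R)^-1 *: heis (cvec al) (- j%:Z) v).
Definition expannih (al : dual G) : nat -> VLdual -> VLdual :=
  fexp (fun j v => - (j%:R)^-1 *: heis (cvec al) j%:Z v).

(* (e^alpha)_m, the coefficient of x^(-m-1) in Y(e^alpha, x). The sums over   *)
(* infinite index sets here and in nop have only finitely many nonzero terms. *)
Definition emode (al : dual G) (m : int) (v : VLdual) : VLdual :=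
  linext (fun b : mon * dual G =>
    \sum_(p \in [set p : (nat * nat)%type |
        p.1%:R - p.2%:R + bform G (dual_val al) (dual_val b.2)
          = - m%:~R - 1 :> rat])
      expcreate al p.1
        (expannih al p.2 (eps al b.2 *: bvec b.1 (al + b.2)))) v.

(* nop [:: (i1, k1); ..] al m is the coefficient of x^(-m-1) in the normally  *)
(* ordered product : d^(k1) beta_i1(x) .. Y(e^al, x) :, where d^(k) is the    *)
(* divided power d^k/k! of d/dx and beta(x) = sum_j beta_j x^(-j-1); it is    *)
(* the m-th mode of (beta_i1)_(-(k1+1)) .. (x) e^al. Creation operators go    *)
(* to the left, beta_j with j >= 0 to the right.                              *)
Fixpoint nop (s : seq ('I_n * nat)) (al : dual G) (m : int) (v : VLdual) :
    VLdual :=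
  match s with
  | [::] => emode al m v
  | (i, k) :: s' =>
      \sum_(j \in [set: nat])
        'C(j, k)%:R *: heis (cbasis i) (Negz j)
                         (nop s' al (m + j%:Z - k%:Z) v)
    + \sum_(j \in [set: nat])
        ((-1) ^+ k * 'C(j + k, k)%:R) *:
          nop s' al (m - j%:Z - k.+1%:Z) (heis (cbasis i) j%:Z v)
  end.

Definition word (m : mon) : seq ('I_n * nat) :=
  flatten [seq nseq (m x) x | x <- finsupp (cmonom_val m)].

(* The mode u_m of Y(u, x), for u in V_L, acting on V_{L^o}. *)
Definition Ymode (u : VLdual) (m : int) (v : VLdual) : VLdual :=
  linext (fun b : mon * dual G => nop (word b.1) b.2 m v) u.

Definition vertex_subalgebra (U : set VLdual) :=
  [/\ subspace U, U `<=` VL, U vac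
    & forall u v m, U u -> U v -> U (Ymode u m v)].

Definition generated_subalgebra (X : set VLdual) : set VLdual :=
  [set w | forall U, vertex_subalgebra U -> X `<=` U -> U w].

(* N is a module, inside V_{L^o}, for the vertex subalgebra A of V_L. *)
Definition submodule (A N : set VLdual) :=
  subspace N /\ forall u v m, A u -> N v -> N (Ymode u m v).

Definition cyclic_module (A : set VLdual) (v : VLdual) : set VLdual :=
  [set w | forall N, submodule A N -> N v -> N w].

Definition module_iso (A M N : set VLdual) :=
  [/\ submodule A M, submodule A N
    & exists phi : VLdual -> VLdual,
      [/\ linear_on M phi, set_bij M N phi
        & forall u v m, A u -> M v -> phi (Ymode u m v) = Ymode u m (phi v)]].

Definition Wgen (R S : {set 'I_n}) : set VLdual :=
  [set v | (exists2 i, i \in R & v = ee (latt G (basis i))) \/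
           (exists2 i, i \in S &
              [\/ v = ee (latt G (basis i)), v = ee (latt G (- basis i))
                | v = bvec (ucm (i, 0%N)) 0])].

Definition W (R S : {set 'I_n}) : set VLdual := generated_subalgebra (Wgen R S).

Definition Wmod (R S : {set 'I_n}) (lam : dual G) : set VLdual :=
  cyclic_module (W R S) (ee lam).

(* S(h^(S)_-), inside S(h^_-). *)
Definition symS (S : {set 'I_n}) : set fock :=
  [set p | forall m : mon, m \in msupp p -> forall x, m x != 0%N -> x.1 \in S].

(* The image of A (x) N under multiplication. *)
Definition tens (A : set fock) (N : set VLdual) : set VLdual :=
  lspan [set v | exists p w, [/\ A p, N w & v = fmul p w]].

End LatticeVertexAlgebra.

(* Main.v *)
Require Import Defs.
From HB Require Import structures.
From mathcomp Require Import all_boot all_order all_algebra.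
From mathcomp Require Import finmap monalg.
From mathcomp Require Import boolp functions fsbigop complex zify ring.
From mathcomp Require Import classical_sets reals.

(* Put h_i(x) = exp(sum_(j >= 1) beta_i(-j) x^j / j) = sum_a h_(i,a) x^a. The   *)
(* modules are known explicitly: for d with d_i >= 0 on R and d = 0 off R u S,  *)
(* the e^(d + lam)-component of W(R, S; lam) is H_d (x) e^(d + lam), where H_d  *)
(* is S(h(S)^-) times the span of the products of coefficients of the h_i(x),   *)
(* i in R, with at most d_i factors h_i for each i. Hence W(R, S; lam) and      *)
(* S(h(S)^-) . sum_d W(R; d + lam) are the same subspace of V_{L^o}, and the    *)
(* isomorphism is the identity.                                                 *)
(*                                                                              *)
(* The sum of the H_d (x) e^(d + lam) is closed under the modes: the creation   *)
(* part of Y(p (x) e^al, x) is the exponential of x (T + al(-1)), with T the    *)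
(* derivation beta(-k) |-> k beta(-k-1), and T + al(-1) preserves H_al because  *)
(* T h_(i,a) = (a + 1) h_(i,a+1) - beta_i(-1) h_(i,a); the annihilation         *)
(* operators lower the indices of the h_(i,a); and Newton's identity            *)
(* a h_(i,a) = sum_k beta_i(-k-1) h_(i,a-k-1) expresses the action of           *)
(* h_(i,a) p by operators that multiply by a single h_(i,b). Conversely,        *)
(* e^rho_m applied to q (x) e^b is h_(rho,a) q (x) e^(rho + b) plus terms in    *)
(* which annihilation operators have lowered the weight of q, so every H_d is   *)
(* reached by induction on the weight.                                          *)

Set Implicit Arguments.
Unset Strict Implicit.
Unset Printing Implicit Defensive.

Import Order.TTheory GRing.Theory Num.Theory.
Local Open Scope classical_set_scope.
Local Open Scope ring_scope.

(** All modules in the statement are instances of one explicit subspace, [hmod R S D lam], the sum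
    over charges d in D of [hfil R S d] (x) e^(d + lam), where [hfil R S d] is the space H_d. The
    capacity bound reflects that each application of e^rho adds rho to the charge and contributes at
    most one factor h_rho.

    That W(R, S; lam) equals [hmod R S (supp2 R S) lam] is [Wmod_eq], with two inclusions. Closure
    under all modes is [hmod_Ymode]: by [Ymode_emb] the modes become operators [fldhat] on
    polynomials, and [hfil_fldhat] shows by counting factors h_i that these respect the H_d; the
    counting rests on [hfil_ttrans] and [fldhat_hser]. Generation is [gen_hmod], whose core is the
    weight induction of [gen_hser].

    The rest is bookkeeping of charges. Multiplying by S(h(S)_-) turns [hmod R set0 D lam] into
    [hmod R S D lam] ([tens_hmod]). A charge supported on R and S splits into its two parts, and H_d
    sees d on R only, so the W(R; delta + lam) sum up to [hmod R set0 (supp2 R S) lam]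
    ([sumspace_hmod]); they live on disjoint sets of charges, so the sum is direct
    ([direct_sum_hmod]). The products are tensor products because W(R; mu) involves no variable of S
    ([is_tensor_fmul]). *)

(** * Subspaces, spans and linear extension from a basis *)

Section Span.
Variable K : fieldType.
Implicit Types X Y : lmodType K.

Lemma subspaceZ X (U : set X) c u : subspace U -> U u -> U (c *: u).
Proof. by move=> [U0 UP] Uu; rewrite -[_ *: _]addr0; apply: UP. Qed.

Lemma subspace_unscale X (U : set X) c u : subspace U -> c != 0 -> U (c *: u) -> U u.
Proof.
by move=> sU c0 /(subspaceZ c^-1 sU); rewrite scalerA mulVf // scale1r.
Qed.

Lemma subspaceD X (U : set X) u v : subspace U -> U u -> U v -> U (u + v).
Proof. by move=> [U0 UP] Uu Uv; rewrite -[u]scale1r; apply: UP. Qed.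

Lemma subspaceP X (U : set X) c u v : subspace U -> U u -> U v -> U (c *: u + v).
Proof. by move=> [_ +] Uu Uv; apply. Qed.

Lemma subspaceN X (U : set X) u : subspace U -> U u -> U (- u).
Proof. by move=> sU Uu; rewrite -scaleN1r; apply: subspaceZ. Qed.

Lemma subspaceB X (U : set X) u v : subspace U -> U u -> U v -> U (u - v).
Proof. by move=> sU Uu Uv; apply: subspaceD => //; apply: subspaceN. Qed.

Lemma subspace_sum X (U : set X) I (r : seq I) (Q : pred I) (F : I -> X) :
  subspace U -> (forall i, Q i -> U (F i)) -> U (\sum_(i <- r | Q i) F i).
Proof.
move=> sU UF; elim/big_rec: _ => [|i x Qi Ux]; first by case: sU.
by apply: subspaceD => //; apply: UF.
Qed.

Lemma subspace_sum_seq X (U : set X) (I : eqType) (r : seq I) (F : I -> X) :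
  subspace U -> (forall i, i \in r -> U (F i)) -> U (\sum_(i <- r) F i).
Proof. by move=> sU UF; rewrite big_seq; apply: subspace_sum. Qed.

Lemma subspace_lspan X (A : set X) : subspace (lspan A).
Proof.
split=> [U [] // |c u v Au Av U sU AU].
by case: (sU) => _; apply; [apply: Au | apply: Av].
Qed.

Lemma lspan0 X (A : set X) : lspan A 0.
Proof. by case: (subspace_lspan A). Qed.

Lemma sub_lspan X (A : set X) : A `<=` lspan A.
Proof. by move=> x Ax U _; apply. Qed.

Lemma lspan_min X (A U : set X) : subspace U -> A `<=` U -> lspan A `<=` U.
Proof. by move=> sU AU x; apply. Qed.

Lemma subspace_preim X Y (f : {linear X -> Y}) (U : set Y) :
  subspace U -> subspace [set x | U (f x)].
Proof.
move=> [U0 UP]; split=> [|c u v Uu Uv] /=; first by rewrite linear0.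
by rewrite linearP; apply: UP.
Qed.

Lemma lspan_image X Y (f : {linear X -> Y}) (A : set X) (U : set Y) :
  subspace U -> (forall x, A x -> U (f x)) -> forall x, lspan A x -> U (f x).
Proof. by move=> sU AU; apply: lspan_min => //; apply: subspace_preim. Qed.

(** Extra indices carry the coefficient zero, so sums for several vectors can be compared over one
    common finite set. *)
Lemma linextEw (I : choiceType) X (f : I -> X) (d : {fset I}) (v : {malg K[I]}) :
  (msupp v `<=` d)%fset -> linext f v = \sum_(b <- d) v@_b *: f b.
Proof.
move=> le; rewrite /linext (big_fset_incl _ le) // => x _ xNv.
by rewrite mcoeff_outdom // scale0r.
Qed.

Lemma linext_is_linear (I : choiceType) X (f : I -> X) : linear (linext f).
Proof.
move=> c u v; pose d := (msupp u `|` msupp v `|` msupp (c *: u + v))%fset.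
rewrite !(@linextEw _ _ f d) ?/d ?fsubsetUr //; last first.
- exact: (fsubset_trans (fsubsetUl _ _) (fsubsetUl _ _)).
- exact: (fsubset_trans (fsubsetUr _ _) (fsubsetUl _ _)).
rewrite scaler_sumr -big_split; apply: eq_bigr => i _ /=.
by rewrite mcoeffD mcoeffZ scalerDl scalerA.
Qed.

HB.instance Definition _ (I : choiceType) X (f : I -> X) :=
  GRing.isLinear.Build K {malg K[I]} X _ (linext f) (linext_is_linear f).

Lemma linextU (I : choiceType) X (f : I -> X) b : linext f << b >> = f b.
Proof.
by rewrite (@linextEw _ _ _ [fset b]%fset) ?msuppU_le // big_seq_fset1 mcoeffUU scale1r.
Qed.

Lemma malg_sumE (I : choiceType) (v : {malg K[I]}) :
  v = \sum_(b <- msupp v) v@_b *: << b >>.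
Proof.
rewrite {1}[v]monalgE; apply: eq_bigr => b _; apply/malgP => i.
by rewrite mcoeffZ !mcoeffU mulr_natr.
Qed.

Lemma subspace_malg (I : choiceType) (U : set {malg K[I]}) v :
  subspace U -> (forall b, b \in msupp v -> U << b >>) -> U v.
Proof.
move=> sU Uv; rewrite [v]malg_sumE; apply: subspace_sum_seq => // b bv.
by apply: subspaceZ => //; apply: Uv.
Qed.

Lemma linear_malgP (I : choiceType) X (f g : {linear {malg K[I]} -> X}) :
  (forall b, f << b >> = g << b >>) -> f =1 g.
Proof.
move=> fg v; rewrite [v]malg_sumE !linear_sum; apply: eq_bigr => b _.
by rewrite !linearZ fg.
Qed.

End Span.

(** * Reindexing of double sums and Newton recursions *)

(** Both sides run over the pairs with i + j < k - 1, a symmetric condition. *)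
Lemma sum_triangle (X : zmodType) k (F : nat -> nat -> X) :
  \sum_(0 <= j < k) \sum_(0 <= i < k - j.+1) F i j =
  \sum_(0 <= i < k) \sum_(0 <= j < k - i.+1) F i j.
Proof.
have E (G : nat -> nat -> X) : \sum_(0 <= j < k) \sum_(0 <= i < k - j.+1) G i j =
    \sum_(0 <= j < k) \sum_(0 <= i < k) if (i + j < k.-1)%N then G i j else 0.
  apply: eq_big_nat => j /andP [_ jk].
  rewrite (@big_nat_widen _ _ _ _ _ k) ?leq_subr // -big_mkcond /=.
  by apply: eq_bigl => i; lia.
rewrite E (E (fun i j => F j i)) exchange_big_nat /=.
by under eq_bigr do under eq_bigr do rewrite addnC.
Qed.

Lemma sum_diag (X : zmodType) k (F : nat -> nat -> X) :
  \sum_(0 <= j < k) \sum_(0 <= i < k - j) F j i =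
  \sum_(0 <= s < k) \sum_(0 <= j < s.+1) F j (s - j)%N.
Proof.
elim: k => [|k IH]; first by rewrite !big_geq.
rewrite [RHS]big_nat_recr // -IH /=.
have -> : \sum_(0 <= j < k) \sum_(0 <= i < k - j) F j i =
    \sum_(0 <= j < k.+1) \sum_(0 <= i < k - j) F j i.
  by rewrite [RHS]big_nat_recr //= subnn [X in _ + X]big_geq // addr0.
rewrite -big_split; apply: eq_big_nat => j /andP [_ jk] /=.
by rewrite subSn // big_nat_recr.
Qed.

(** In characteristic zero the recursion determines each term from the earlier ones. Formal
    exponentials are compared below through this uniqueness. *)
Lemma eq_newton (K : fieldType) (X : lmodType K) (o : nat -> X -> X) (u w : nat -> X) :
  [pchar K] =i pred0 -> u 0%N = w 0%N ->
  (forall k, k%:R *: u k = \sum_(0 <= j < k) o j (u (k - j.+1)%N)) ->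
  (forall k, k%:R *: w k = \sum_(0 <= j < k) o j (w (k - j.+1)%N)) -> u =1 w.
Proof.
move=> charK0 uw0 uE wE k; elim/ltn_ind: k => -[//|k] IH.
have k0 : k.+1%:R != 0 :> K by rewrite ((pcharf0P K).1 charK0).
apply: (scalerI k0); rewrite uE wE; apply: eq_big_nat => j jk.
by rewrite IH //; lia.
Qed.

Lemma linear_scale_comp (K : fieldType) (X Y Z : lmodType K) (d : K)
    (f : Y -> Z) (g : X -> Y) : linear f -> linear g -> linear (fun w => d *: f (g w)).
Proof.
by move=> lf lg c u v; rewrite lg lf scalerDr !scalerA [c * _]mulrC.
Qed.

Lemma scale_interchange (K : fieldType) (X : lmodType K) (c d : K) (x y x' y' : X) :
  d *: (c *: x + y) + (c *: x' + y') = c *: (d *: x + x') + (d *: y + y').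
Proof. by rewrite !scalerDr !scalerA [d * _]mulrC addrACA. Qed.

Lemma scale_exchange (K : fieldType) (X : lmodType K) (c d : K) (x y : X) :
  c *: (d *: x) + d *: y = d *: (c *: x + y).
Proof. by rewrite scalerDr !scalerA [c * _]mulrC. Qed.

Lemma linear_sum_add (K : fieldType) (X Y : lmodType K) B (F F' : nat -> X -> Y) :
  (forall j, linear (F j)) -> (forall j, linear (F' j)) ->
  linear (fun w => \sum_(0 <= j < B) F j w + \sum_(0 <= j < B) F' j w).
Proof.
move=> lF lF' c u v; rewrite scalerDr addrACA.
by congr (_ + _); rewrite scaler_sumr -big_split; apply: eq_bigr => j _; rewrite ?lF ?lF'.
Qed.

(** * Formal exponentials of operator series *)

Section FormalExp.
Variables (K : fieldType) (charK0 : [pchar K] =i pred0).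
Implicit Types X Y : lmodType K.

Lemma fpowS X (a : nat -> X -> X) r k v :
  fpow a r.+1 k v = \sum_(0 <= j < k) a j.+1 (fpow a r (k - j.+1) v).
Proof. by rewrite /= big_add1. Qed.

(** The series starts in degree one, so its r-th power starts in degree r. *)
Lemma fpow_gt X (a : nat -> X -> X) r k v :
  (forall j, a j 0 = 0) -> (k < r)%N -> fpow a r k v = 0.
Proof.
move=> a0; elim: r k => // r IH k kr; rewrite fpowS big_nat_cond big1 // => j jk.
by rewrite IH ?a0 //; lia.
Qed.

Lemma fexpEw X (a : nat -> X -> X) R k v :
  (forall j, a j 0 = 0) -> (k < R)%N ->
  fexp a k v = \sum_(0 <= r < R) (r`!%:R)^-1 *: fpow a r k v.
Proof.
move=> a0 kR; rewrite /fexp -(big_mkord xpredT (fun r => (r`!%:R)^-1 *: fpow a r k v)).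
rewrite [RHS](big_cat_nat (n := k.+1)) //= [X in _ + X]big_nat_cond.
rewrite [X in _ + X]big1 ?addr0 // => r /andP [/andP [kr _] _].
by rewrite fpow_gt ?scaler0.
Qed.

Lemma fexp0 X (a : nat -> X -> X) v : fexp a 0 v = v.
Proof. by rewrite /fexp big_ord_recl big_ord0 addr0 /= invr1 scale1r. Qed.

Lemma fpow_stable X (a : nat -> X -> X) (U : set X) r k v :
  subspace U -> (forall j w, U w -> U (a j.+1 w)) -> U v -> U (fpow a r k v).
Proof.
move=> sU aU Uv; elim: r k => [k|r IH k]; last first.
  by rewrite fpowS; apply: subspace_sum => // j _; apply: aU.
by move=> /=; case: ifP => // _; case: sU.
Qed.

Lemma fexp_stable X (a : nat -> X -> X) (U : set X) k v :
  subspace U -> (forall j w, U w -> U (a j.+1 w)) -> U v -> U (fexp a k v).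
Proof.
move=> sU aU Uv; apply: subspace_sum => // r _.
by apply: subspaceZ => //; apply: fpow_stable.
Qed.

Lemma fexp_morph X Y (e : {linear X -> Y}) a a' k v :
  (forall j w, e (a j.+1 w) = a' j.+1 (e w)) -> e (fexp a k v) = fexp a' k (e v).
Proof.
move=> ea; have eaP s i : e (fpow a s i v) = fpow a' s i (e v).
  elim: s i => [|s IH] i /=; first by case: ifP; rewrite ?linear0.
  by rewrite !big_add1 linear_sum; apply: eq_bigr => j _; rewrite ea IH.
by rewrite linear_sum; apply: eq_bigr => r _; rewrite linearZ eaP.
Qed.

Lemma fexp_is_linear X (a : nat -> X -> X) k :
  (forall j, linear (a j.+1)) -> linear (fexp a k).
Proof.
move=> la c u v; rewrite /fexp scaler_sumr -big_split; apply: eq_bigr => r _ /=.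
have fpowP s i : fpow a s i (c *: u + v) = c *: fpow a s i u + fpow a s i v.
  elim: s i => [|s IH] i; first by rewrite /=; case: ifP; rewrite ?scaler0 ?addr0.
  rewrite !fpowS scaler_sumr -big_split; apply: eq_bigr => j _ /=.
  by rewrite IH la.
by rewrite fpowP scalerDr !scalerA [c * _]mulrC.
Qed.

Section Newton.
Variables (X : lmodType K) (c : nat -> K) (o : nat -> {linear X -> X}).
Hypothesis oC : forall i j v, o i (o j v) = o j (o i v).
Let a j v := c j *: o j v.

Let a0 j : a j 0 = 0. Proof. by rewrite /a linear0 scaler0. Qed.
Let aZ j b v : a j (b *: v) = b *: a j v.
Proof. by rewrite /a linearZ scalerA mulrC -scalerA. Qed.
Let a_sum j I (r : seq I) (F : I -> X) :
  a j (\sum_(i <- r) F i) = \sum_(i <- r) a j (F i).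
Proof. by rewrite /a linear_sum scaler_sumr. Qed.
Let aC i j v : a i (a j v) = a j (a i v).
Proof. by rewrite /a !linearZ /= !scalerA oC mulrC. Qed.

(** Coefficientwise, x d/dx a(x)^(r+1) = (r + 1) (x a'(x)) a(x)^r, valid because the a_j commute. *)
Lemma fpow_newton r k v : k%:R *: fpow a r.+1 k v =
  r.+1%:R *: \sum_(0 <= j < k) j.+1%:R *: a j.+1 (fpow a r (k - j.+1) v).
Proof.
elim: r k => [|r IH] k.
  rewrite scale1r fpowS scaler_sumr; apply: eq_big_nat => j /andP [_ jk] /=.
  case: eqP => [e|_]; last by rewrite a0 !scaler0.
  by have -> : k = j.+1 by lia.
rewrite fpowS [LHS]scaler_sumr.
(* Write k as (j + 1) + (k - j - 1): the first part differentiates the outermost factor, the second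
   is treated by induction. *)
transitivity (\sum_(0 <= j < k) j.+1%:R *: a j.+1 (fpow a r.+1 (k - j.+1) v) +
  r.+1%:R *: \sum_(0 <= j < k) \sum_(0 <= i < k - j.+1)
     i.+1%:R *: a i.+1 (a j.+1 (fpow a r (k - i.+1 - j.+1) v))).
  rewrite scaler_sumr -big_split; apply: eq_big_nat => j /andP [_ jk] /=.
  rewrite -{1}(subnKC jk) natrD scalerDl; congr (_ + _).
  rewrite -aZ IH aZ a_sum; congr (_ *: _); apply: eq_bigr => i _.
  by rewrite aZ aC -!subnDA addnC.
rewrite sum_triangle -[in RHS]add1n natrD scalerDl scale1r; congr (_ + _ *: _).
apply: eq_bigr => i _; rewrite fpowS -scaler_sumr -a_sum //.
Qed.

(** Coefficientwise, x d/dx exp(a(x)) = (x a'(x)) exp(a(x)). *)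
Lemma fexp_newton k v : k%:R *: fexp a k v =
  \sum_(0 <= j < k) j.+1%:R *: a j.+1 (fexp a (k - j.+1) v).
Proof.
rewrite (@fexpEw _ _ k.+1) // scaler_sumr big_nat_recl //.
transitivity (\sum_(0 <= r < k) \sum_(0 <= j < k)
  j.+1%:R *: a j.+1 ((r`!%:R)^-1 *: fpow a r (k - j.+1) v)).
  rewrite [X in X + _](_ : _ = 0) ?add0r; last first.
    by case: (k) => [|k']; rewrite ?scale0r //= !scaler0.
  apply: eq_bigr => r _; rewrite scalerA [k%:R * _]mulrC -scalerA fpow_newton scalerA.
  have -> : (r.+1`!%:R)^-1 * r.+1%:R = (r`!%:R)^-1 :> K.
    have r0 : r.+1%:R != 0 :> K by rewrite ((pcharf0P K).1 charK0).
    by rewrite factS natrM invfM mulrAC mulVf // mul1r.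
  by rewrite scaler_sumr; apply: eq_bigr => j _; rewrite aZ !scalerA [_ * j.+1%:R]mulrC.
rewrite exchange_big_nat; apply: eq_big_nat => j jk /=.
by rewrite -scaler_sumr -a_sum -fexpEw //; lia.
Qed.

End Newton.
End FormalExp.

Section Multiplication.
Variables (K : fieldType) (A : comAlgType K).

Definition mulp (a p : A) := a * p.

Lemma mulp_is_linear a : linear (mulp a).
Proof. by move=> c p q; rewrite /mulp mulrDr scalerAr. Qed.

HB.instance Definition _ a :=
  GRing.isLinear.Build K A A _ (mulp a) (mulp_is_linear a).

Lemma mulpC a b p : mulp a (mulp b p) = mulp b (mulp a p).
Proof. exact: mulrCA. Qed.

End Multiplication.

(** * Monomials as words, and derivations of the polynomial ring *)

Section MonomialWords.
Variable I : choiceType.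
Implicit Types (t : seq I) (m : {cmonom I}) (x y : I).

Definition mprod t : {cmonom I} := foldr (fun x m => mmul (ucm x) m) mone t.
Definition mword m : seq I :=
  flatten [seq nseq (m x) x | x <- finsupp (cmonom_val m)].

Lemma mprodE t y : mprod t y = count_mem y t.
Proof. by elim: t => [|x t IH] /=; rewrite ?cm1 // cmM cmU IH. Qed.

Lemma count_mword m y : count_mem y (mword m) = m y.
Proof.
rewrite /mword count_flatten -map_comp sumnE big_map.
under eq_bigr => x _ do rewrite /= count_nseq /=.
have [ym|yNm] := boolP (y \in finsupp (cmonom_val m)).
  rewrite (big_fsetD1 y) //= eqxx mul1n big1_seq ?addn0 // => x.
  by rewrite in_fsetD1 => /andP [_ /andP [/negPf -> _]].
rewrite big1_seq => [|x /andP [_ xm]]; first by apply/esym/eqP; rewrite cmE_eq0.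
by case: eqP => // xy; rewrite -xy xm in yNm.
Qed.

Lemma mem_mword m y : (y \in mword m) = (m y != 0%N).
Proof. by rewrite -count_mword -has_pred1 has_count lt0n. Qed.

Lemma mwordK m : mprod (mword m) = m.
Proof. by apply/eqP/cmP => y; rewrite mprodE count_mword. Qed.

Lemma perm_mword t : perm_eq (mword (mprod t)) t.
Proof. by apply/allP => y _ /=; rewrite count_mword mprodE. Qed.

End MonomialWords.

Section PolynomialRing.
Variables (K : fieldType) (I : choiceType).
Local Notation P := {malg K[{cmonom I}]}.
Implicit Types (t : seq I) (m : {cmonom I}) (x y : I) (p q : P).

Definition var x : P := << ucm x >>.
Definition vprod t : P := << mprod t >>.

Lemma malgUM m1 m2 : << m1 >> * << m2 >> = << mmul m1 m2 >> :> P.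
Proof. by rewrite malgM_def fgmulUU mul1r. Qed.

Lemma vprod_cons x t : vprod (x :: t) = var x * vprod t.
Proof. by rewrite malgUM. Qed.

Lemma vprod_word m : vprod (mword m) = << m >>.
Proof. by rewrite /vprod mwordK. Qed.

Lemma vprodE t : vprod t = \prod_(x <- t) var x.
Proof. by elim: t => [|x t IH]; rewrite ?big_nil // big_cons vprod_cons IH. Qed.

Lemma subspace_vprod (U : set P) p :
  subspace U -> (forall t, U (vprod t)) -> U p.
Proof. by move=> sU UP; apply: subspace_malg => // m _; rewrite -vprod_word. Qed.

Definition deriv (g : I -> P) : P -> P :=
  linext (fun m => \sum_(x <- finsupp (cmonom_val m))
    (m x)%:R *: (g x * << divcm m (ucm x) >>)).

HB.instance Definition _ g := GRing.Linear.on (deriv g).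

Lemma derivUw g m (d : {fset I}) : (finsupp (cmonom_val m) `<=` d)%fset ->
  deriv g << m >> = \sum_(x <- d) (m x)%:R *: (g x * << divcm m (ucm x) >>).
Proof.
move=> le; rewrite /deriv linextU; apply: big_fset_incl => // x _ xNm.
have /eqP -> : m x == 0%N by rewrite cmE_eq0.
by rewrite scale0r.
Qed.

Lemma deriv1 g : deriv g 1 = 0.
Proof.
by rewrite (@derivUw g mone fset0) ?big_seq_fset0 // mdom1.
Qed.

Lemma derivXM g x p : deriv g (var x * p) = g x * p + var x * deriv g p.
Proof.
pose f := [the {linear P -> P} of deriv g \o mulp (var x)].
pose f' := [the {linear P -> P} of mulp (g x) \+ (mulp (var x) \o deriv g)].
suff: f =1 f' by apply.
apply: linear_malgP => m; rewrite /= /mulp malgUM {f f'}.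
(* One finite index set serves both monomials; the term of [x] is split off, since only there does
   the exponent change. *)
pose d := (x |` finsupp (cmonom_val m))%fset.
have le1 : (finsupp (cmonom_val m) `<=` d)%fset by apply: fsubsetUr.
have le2 : (finsupp (cmonom_val (mmul (ucm x) m)) `<=` d)%fset.
  by rewrite mdomD mdomU; apply: fsubset_refl.
have xd : x \in d by rewrite in_fset1U eqxx.
apply: (etrans (derivUw g le2)); rewrite (derivUw g le1); move: (d) xd => {le1 le2} e xe.
rewrite [LHS](big_fsetD1 x xe). 
rewrite [X in _ + _ * X](big_fsetD1 x xe). 
rewrite mulrDr.
rewrite addrA.
congr (_ + _).
  rewrite cmM cmU eqxx.
  have -> : divcm (mmul (ucm x) m) (ucm x) = m.
    by apply/eqP/cmP => y; rewrite divcmE cmM addKn.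
  rewrite natrD scalerDl scale1r; congr (_ + _).
  (* [divcm] truncates at exponent zero, where identity [E] would fail; the coefficient is zero
     there. *)
  case: (eqVneq (m x) 0%N) => [m0|m0].
    rewrite m0 mulr0n. rewrite [LHS]scale0r. rewrite [X in _ * X]scale0r. by rewrite mulr0.
  have E : mmul (ucm x) (divcm m (ucm x)) = m.
    apply/eqP/cmP => y; rewrite cmM cmU divcmE cmU.
    by case: eqP => [<-|] //=; lia.
  rewrite -[RHS]scalerAr.
  rewrite [in RHS]mulrCA.
  rewrite malgUM.
  by rewrite E.
rewrite mulr_sumr; apply: eq_big_seq => y; rewrite in_fsetD1 => /andP [yx _].
rewrite cmM cmU eq_sym (negPf yx) add0n.
case: (eqVneq (m y) 0%N) => [m0|m0].
  rewrite m0 mulr0n. rewrite [LHS]scale0r. rewrite [X in _ * X]scale0r. by rewrite mulr0.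
have E : mmul (ucm x) (divcm m (ucm y)) = divcm (mmul (ucm x) m) (ucm y).
  apply/eqP/cmP => z; rewrite divcmE !cmM !cmU divcmE cmU.
  case: (eqVneq y z) => [<-|] //=; last by lia.
  by rewrite eq_sym (negPf yx).
rewrite -[RHS]scalerAr. 
rewrite [in RHS]mulrCA.
rewrite malgUM.
by rewrite E.
Qed.

Definition pd x : P -> P := deriv (fun y => (y == x)%:R).
HB.instance Definition _ x := GRing.Linear.on (pd x).

Lemma pdU x m : pd x << m >> = (m x)%:R *: << divcm m (ucm x) >>.
Proof.
pose d := (x |` finsupp (cmonom_val m))%fset.
have xd : x \in d by rewrite in_fset1U eqxx.
have le1 : (finsupp (cmonom_val m) `<=` d)%fset by apply: fsubsetUr.
rewrite /pd (derivUw _ le1) (big_fsetD1 x xd) /= eqxx mul1r.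
rewrite big1_seq ?addr0 // => y /andP [_]; rewrite in_fsetD1 => /andP [/negPf -> _].
by rewrite mul0r scaler0.
Qed.

End PolynomialRing.

Section PolynomialExtension.
Variables (K : fieldType) (I : choiceType) (X : lmodType K) (f : seq I -> X).
Hypothesis f_perm : forall s t, perm_eq s t -> f s = f t.

Lemma linext_vprod t : linext (fun m => f (mword m)) (vprod K t) = f t.
Proof. by rewrite linextU; apply/f_perm/perm_mword. Qed.

End PolynomialExtension.

(* Proofs are carried out over an abstract polynomial ring: unification is    *)
(* intractable over {malg K[{cmonom I}]}, whose operations unfold.            *)
Record polyRing (K : fieldType) (I : eqType) := PolyRing {
  pcar :> comAlgType K;
  pvar : I -> pcar;
  pder : (I -> pcar) -> {linear pcar -> pcar};
  pspan : forall U : set pcar, subspace U ->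
    (forall t, U (\prod_(x <- t) pvar x)) -> forall p, U p;
  pext : forall (X : lmodType K) (f : seq I -> X),
    (forall s t, perm_eq s t -> f s = f t) ->
    exists g : {linear pcar -> X}, forall t, g (\prod_(x <- t) pvar x) = f t;
  pder1 : forall g, pder g 1 = 0;
  pderXM : forall g x p, pder g (pvar x * p) = g x * p + pvar x * pder g p }.

(** * Derivations of an abstract polynomial ring *)

Section Derivations.
Variables (K : fieldType) (I : eqType) (P : polyRing K I).
Implicit Types (p q : P) (g : I -> P).

Lemma plinearP (X : lmodType K) (f f' : {linear P -> X}) :
  (forall t, f (\prod_(x <- t) pvar P x) = f' (\prod_(x <- t) pvar P x)) -> f =1 f'.
Proof.
move=> ff'; apply: (@pspan _ _ P [set p | f p = f' p]) => //.
by split=> [|c u v /= Eu Ev] /=; rewrite ?linear0 // !linearP Eu Ev.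
Qed.

Lemma pder_var g x : pder g (pvar P x) = g x.
Proof. by rewrite -[pvar P x]mulr1 pderXM pder1 mulr0 addr0 mulr1. Qed.

Lemma pderM g p q : pder g (p * q) = pder g p * q + p * pder g q.
Proof.
suff E r : pder g (q * r) = q * pder g r + pder g q * r.
  by rewrite [p * q]mulrC [_ * q]mulrC [p * _]mulrC.
pose f := [the {linear P -> P} of pder g \o mulp q].
pose f' := [the {linear P -> P} of (mulp q \o pder g) \+ mulp (pder g q)].
suff: f =1 f' by apply.
apply: plinearP; rewrite /= /mulp.
elim=> [|x t IH]; first by rewrite big_nil pder1 !mulr1 mulr0 add0r.
rewrite big_cons mulrCA !pderXM IH; ring.
Qed.

(** The commutator of two derivations is a derivation, so it is determined by the variables. *)
Lemma pderC g1 g2 p : (forall x, pder g1 (g2 x) = pder g2 (g1 x)) ->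
  pder g1 (pder g2 p) = pder g2 (pder g1 p).
Proof.
move=> gC.
pose f := [the {linear P -> P} of pder g1 \o pder g2].
pose f' := [the {linear P -> P} of pder g2 \o pder g1].
suff: f =1 f' by apply.
apply: plinearP; rewrite /=; elim=> [|x t IH].
  by rewrite big_nil !pder1 !linear0.
rewrite big_cons !pderXM !linearD /= !pderM !pder_var gC IH; ring.
Qed.

Lemma pder_sum J (r : seq J) (g : J -> I -> P) p :
  pder (fun x => \sum_(j <- r) g j x) p = \sum_(j <- r) pder (g j) p.
Proof.
apply: (@pspan _ _ P [set p | pder (fun x => \sum_(j <- r) g j x) p =
    \sum_(j <- r) pder (g j) p]) => [|t].
  split=> [|c u v /= Eu Ev] /=.
    by rewrite linear0 big1 // => j _; rewrite linear0.
  rewrite linearP Eu Ev scaler_sumr -big_split; apply: eq_bigr => j _.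
  by rewrite linearP.
rewrite /=; elim: t => [|x t IH].
  by rewrite big_nil pder1 big1 // => j _; rewrite pder1.
rewrite big_cons pderXM IH mulr_suml mulr_sumr -big_split.
by apply: eq_bigr => j _; rewrite pderXM.
Qed.

Lemma pderZ c g p : pder (fun x => c *: g x) p = c *: pder g p.
Proof.
apply: (@pspan _ _ P [set p | pder (fun x => c *: g x) p = c *: pder g p]) => [|t].
  split=> [|b u v /= Eu Ev] /=; first by rewrite !linear0 ?scaler0.
  by rewrite linearP Eu Ev (linearP (pder g)) scalerDr !scalerA [c * _]mulrC.
rewrite /=; elim: t => [|x t IH]; first by rewrite big_nil !pder1 scaler0.
by rewrite big_cons !pderXM IH scalerDr -scalerAl -scalerAr.
Qed.

Lemma eq_pder g g' p : g =1 g' -> pder g p = pder g' p.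
Proof. by move=> /funext ->. Qed.

End Derivations.

(** * The series h_i(x), annihilation operators and translation *)

Section HeisenbergFock.
Variables (K : fieldType) (charK0 : [pchar K] =i pred0) (n : nat).
Variable P : polyRing K ('I_n * nat)%type.
Implicit Types (p q : P) (i : 'I_n).
Local Notation var i k := (pvar P (i, k%N)).

Let natK0 k : k.+1%:R != 0 :> K.
Proof. by rewrite ((pcharf0P K).1 charK0). Qed.

(* The coefficient of x^a in exp(sum_(j >= 1) beta_i(-j) x^j / j). *)
Definition hser i a : P := fexp (fun j p => (j%:R)^-1 *: mulp (var i j.-1) p) a 1.

Lemma hser0 i : hser i 0 = 1. Proof. exact: fexp0. Qed.

(** Reading [var i k] as the power sum p_(k+1), [hser i a] is the complete symmetric function h_a,
    and this is Newton's identity. *)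
Lemma hser_newton i a :
  a%:R *: hser i a = \sum_(0 <= k < a) var i k * hser i (a - k.+1).
Proof.
rewrite (fexp_newton charK0 (fun j => (j%:R)^-1)
  (o := fun j => [the {linear P -> P} of mulp (var i j.-1)])).
  by apply: eq_bigr => k _; rewrite /= scalerA mulfV // scale1r.
by move=> j k p; apply: mulpC.
Qed.

Lemma hser1 i : hser i 1 = var i 0.
Proof. by have := hser_newton i 1; rewrite big_nat1 subnn hser0 mulr1 mulr1n scale1r. Qed.

(* The operator [j >= 1, h with <h, beta_i> = c i]: h_j, here with j = k + 1. *)
Definition dann (c : 'I_n -> K) (k : nat) : {linear P -> P} :=
  pder (fun x => if x.2 == k then (k.+1%:R * c x.1)%:A else 0).

(** The coordinate form in which [heis] defines the positive modes. *)
Lemma dannE c k p : dann c k p =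
  \sum_i (k.+1%:R * c i) *: pder (fun x => (x == (i, k))%:R) p.
Proof.
under eq_bigr do rewrite -pderZ.
rewrite -pder_sum; apply: eq_pder => -[i j] /=.
case: eqP => [->|jk].
  rewrite (bigD1 i) //= eqxx /= big1 ?addr0 // => l /negPf li.
  by rewrite xpair_eqE eq_sym li scaler0.
by rewrite big1 // => l _; rewrite xpair_eqE (introF eqP jk) andbF scaler0.
Qed.

Lemma dannC c k c' k' p : dann c k (dann c' k' p) = dann c' k' (dann c k p).
Proof.
apply: pderC => x.
by case: ifP; case: ifP; rewrite ?linear0 // !linearZ /= !pder1 !scaler0.
Qed.

(** The mode j = k + 1 sends the exponent sum_l beta_i(-l) x^l / l to c_i x^j, hence multiplies
    h_i(x) by c_i x^j. *)
Lemma dann_hser c k i a :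
  dann c k (hser i a) = if (k < a)%N then c i *: hser i (a - k.+1) else 0.
Proof.
elim/ltn_ind: a => -[|a] IH; first by rewrite hser0 [LHS]pder1.
apply: (scalerI (natK0 a)); rewrite -linearZ (hser_newton i a.+1) linear_sum /=.
under eq_big_nat => j /andP [_ ja].
  rewrite [dann _ _ _]pderXM /= IH; last by lia.
  over.
rewrite big_split /=.
rewrite (_ : \sum_(0 <= j < a.+1) _ * hser i (a.+1 - j.+1) =
  if (k < a.+1)%N then (k.+1%:R * c i) *: hser i (a.+1 - k.+1) else 0); last first.
  case: ifP => ka.
    rewrite (bigD1_seq k) ?mem_index_iota ?iota_uniq //= eqxx mulr_algl.
    by rewrite big1 ?addr0 // => j /negPf ->; rewrite mul0r.
  rewrite big_nat_cond big1 // => j; case: eqP => [->|]; first by rewrite ka andbF.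
  by rewrite mul0r.
case: ifP => ka; last first.
  rewrite scaler0 add0r big_nat_cond big1 // => j ja.
  by rewrite ifF ?mulr0 //; lia.
(* The remaining terms form Newton's identity for [a - k]; with the term j = k the coefficient
   becomes (k + 1) + (a - k) = a + 1. *)
rewrite (_ : \sum_(0 <= j < a.+1) _ = (c i * (a - k)%:R) *: hser i (a - k)).
  rewrite subSS -scalerDl scalerA; congr (_ *: _).
  by rewrite [k.+1%:R * _]mulrC -mulrDr -natrD mulrC; congr (_%:R * _); lia.
rewrite -scalerA hser_newton scaler_sumr (big_cat_nat (n := (a - k)%N)) //=; last by lia.
rewrite [X in _ + X]big_nat_cond [X in _ + X]big1 ?addr0 => [|j ja]; last first.
  by rewrite ifF ?mulr0 //; lia.
apply: eq_big_nat => j ja; rewrite ifT; last by lia.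
by rewrite scalerAr; congr (_ * (_ *: hser _ _)); lia.
Qed.

Definition dtrans : {linear P -> P} :=
  pder (fun x => x.2.+1%:R *: var x.1 x.2.+1).

(** T sends sum_(j >= 1) beta_i(-j) x^j / j to its x-derivative minus beta_i(-1), hence h_i(x) to
    h_i'(x) - beta_i(-1) h_i(x). *)
Lemma dtrans_hser i a :
  dtrans (hser i a) = a.+1%:R *: hser i a.+1 - var i 0 * hser i a.
Proof.
elim/ltn_ind: a => -[|a] IH.
  by rewrite hser0 [dtrans 1]pder1 scale1r hser1 mulr1 subrr.
apply: (scalerI (natK0 a)); rewrite -linearZ (hser_newton i a.+1) linear_sum /=.
under eq_big_nat => j /andP [_ ja].
  rewrite [dtrans (_ * _)]pderXM /= IH; last by lia.
  rewrite (_ : (a.+1 - j.+1).+1 = a.+1 - j)%N; last by lia.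
  rewrite mulrBr addrA.
  over.
rewrite sumrB scalerBr; congr (_ - _); last first.
  rewrite scalerAr hser_newton mulr_sumr; apply: eq_bigr => j _.
  by rewrite mulrCA.
rewrite big_split /= [in RHS]hser_newton scaler_sumr.
rewrite [X in _ + X]big_nat_recl // [in RHS]big_nat_recl // addrCA; congr (_ + _).
  by rewrite scalerAr subn0 subSS subn0.
rewrite [in RHS]big_nat_recr // [X in X + _]big_nat_recr //= addrAC; congr (_ + _); last first.
  by rewrite -scalerAl; congr (_ *: (_ * hser _ _)); lia.
rewrite -big_split; apply: eq_big_nat => j ja /=.
rewrite -scalerAl -scalerAr -scalerDl -natrD.
by congr (_%:R *: (_ * hser _ _)); lia.
Qed.

End HeisenbergFock.

(** * The subspaces H_d *)

Section Filtration.
Variables (K : fieldType) (charK0 : [pchar K] =i pred0) (n : nat).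
Variable P : polyRing K ('I_n * nat)%type.
Implicit Types (p q : P) (i : 'I_n) (S : {set 'I_n}) (d : 'rV[int]_n).
Local Notation var i k := (pvar P (i, k%N)).
Local Notation hs := (hser P).
Local Notation dtrans := (dtrans P).
Local Notation dann := (dann P).

Let natK0 k : k.+1%:R != 0 :> K.
Proof. by rewrite ((pcharf0P K).1 charK0). Qed.

Definition symw (S : {set 'I_n}) : set P :=
  lspan [set p | exists2 t, all (fun x => x.1 \in S) t & p = \prod_(x <- t) pvar P x].

Lemma subspace_symw S : subspace (symw S).
Proof. exact: subspace_lspan. Qed.

Lemma symw1 S : symw S 1.
Proof. by apply: sub_lspan; exists [::]; rewrite ?big_nil. Qed.

Lemma symw_varM S x p : x.1 \in S -> symw S p -> symw S (pvar P x * p).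
Proof.
move=> xS; apply: (lspan_image (f := [the {linear P -> P} of mulp (pvar P x)])).
  exact: subspace_lspan.
move=> _ [t tS ->]; apply: sub_lspan; exists (x :: t); first by rewrite /= xS.
by rewrite big_cons.
Qed.

Lemma symwM S p q : symw S p -> symw S q -> symw S (p * q).
Proof.
move=> Sp Sq; rewrite mulrC; move: p Sp.
apply: (lspan_image (f := [the {linear P -> P} of mulp q])).
  exact: subspace_lspan.
move=> _ [t tS ->]; rewrite /= /mulp mulrC; elim: t tS => [|x t IH] /=.
  by rewrite big_nil mul1r.
by move=> /andP [xS tS]; rewrite big_cons -mulrA; apply: symw_varM => //; apply: IH.
Qed.

Lemma symw_der S g p : (forall x, x.1 \in S -> symw S (g x)) ->
  symw S p -> symw S (pder g p).
Proof.
move=> gS; apply: lspan_image; first exact: subspace_lspan.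
move=> _ [t tS ->]; elim: t tS => [|x t IH] /=.
  by rewrite big_nil pder1 => _; apply: lspan0.
move=> /andP [xS tS]; rewrite big_cons pderXM.
apply: (subspaceD (subspace_symw S)).
  by apply: symwM; [apply: gS | apply: sub_lspan; exists t].
by apply: symw_varM => //; apply: IH.
Qed.

(** The list [l] prescribes which series contribute a factor, while the indices are free; since
    [hser i 0] is 1, a factor may be trivial. *)
Definition hprods (l : seq 'I_n) : set P :=
  lspan [set p | exists2 t, map fst t = l & p = \prod_(x <- t) hs x.1 x.2].

Lemma subspace_hprods l : subspace (hprods l).
Proof. exact: subspace_lspan. Qed.

Lemma hprods_cons i a l q : hprods l q -> hprods (i :: l) (hs i a * q).
Proof.
apply: (lspan_image (f := [the {linear P -> P} of mulp (hs i a)])).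
  exact: subspace_hprods.
move=> _ [t <- ->]; apply: sub_lspan; exists ((i, a) :: t) => //.
by rewrite big_cons.
Qed.

Lemma hprods_nil : hprods [::] 1.
Proof. by apply: sub_lspan; exists [::]; rewrite ?big_nil. Qed.

Lemma hprodsM l l' q q' : hprods l q -> hprods l' q' -> hprods (l ++ l') (q * q').
Proof.
move=> lq l'q'; rewrite mulrC; move: q lq.
apply: (lspan_image (f := [the {linear P -> P} of mulp q'])).
  exact: subspace_hprods.
move=> _ [t <- ->]; rewrite /= /mulp mulrC; elim: t => [|x t IH].
  by rewrite big_nil mul1r.
by rewrite big_cons -mulrA; apply: hprods_cons.
Qed.

Lemma hprods_der g l q :
  (forall i a, i \in l -> hprods [:: i] (pder g (hs i a))) ->
  hprods l q -> hprods l (pder g q).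
Proof.
move=> gH; apply: lspan_image; first exact: subspace_hprods.
move=> _ [t tl ->]; elim: t l tl gH => [|[i a] t IH] _ /= <- gH.
  by rewrite big_nil pder1; apply: lspan0.
rewrite big_cons pderM; apply: (subspaceD (subspace_hprods _)).
  rewrite mulrC; set r := \prod_(j <- t) _.
  move: (pder g (hs i a)) (gH i a (mem_head _ _)) => /= u.
  apply: (lspan_image (f := [the {linear P -> P} of mulp r])).
    exact: subspace_hprods.
  move=> _ [[|[j b] []] //= [ji] ->]; rewrite big_seq1 /= /mulp mulrC ji.
  by apply: hprods_cons; apply: sub_lspan; exists t.
by apply: hprods_cons; apply: IH => // j b jt; apply: gH; rewrite inE jt orbT.
Qed.

(** Each factor absorbs its own beta_i(-1): by [dtrans_hser], T + beta_i(-1) only raises the index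
    of h_(i,a). *)
Lemma hprods_dtrans l q :
  hprods l q -> hprods l (dtrans q + (\sum_(i <- l) var i 0) * q).
Proof.
apply: (lspan_image
  (f := [the {linear P -> P} of dtrans \+ mulp (\sum_(i <- l) var i 0)])).
  exact: subspace_hprods.
move=> _ [t tl ->] /=; rewrite /mulp; elim: t l tl => [|[i a] t IH] _ /= <-.
  by rewrite !big_nil pder1 mul0r addr0; apply: lspan0.
have /IH {}IH := erefl (map fst t).
rewrite !big_cons pderM [pder _ _](dtrans_hser charK0) /=.
set p := \prod_(x <- t) _ in IH *; set s := \sum_(x <- _) _ in IH *.
rewrite -/dtrans [X in hprods _ X](_ : _ =
    a.+1%:R *: (hs i a.+1 * p) + hs i a * (dtrans p + s * p)).
  apply: (subspaceD (subspace_hprods _)).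
    apply: (subspaceZ _ (subspace_hprods _)).
    by apply: hprods_cons; apply: sub_lspan; exists t.
  exact: hprods_cons.
rewrite scalerAl; move: (_ *: hs i a.+1) (dtrans p) => u v.
by rewrite /dtrans; ring.
Qed.

(** The capacity bound. If d is negative somewhere on R, no list qualifies and [hfil] is zero, so
    such charges drop out by themselves. *)
Definition hcap (R : {set 'I_n}) (d : 'rV[int]_n) (l : seq 'I_n) :=
  all (mem R) l && [forall i in R, (count_mem i l)%:Z <= d 0 i].

(* The e^(d + lam)-component of W(R, S; lam). *)
Definition hfil (R S : {set 'I_n}) (d : 'rV[int]_n) : set P :=
  lspan [set r | exists l p q, [/\ hcap R d l, symw S p, hprods l q & r = p * q]].

Variables R S : {set 'I_n}.
Local Notation H := (hfil R S).

Lemma subspace_hfil d : subspace (H d).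
Proof. exact: subspace_lspan. Qed.

Lemma hfilI d l p q : hcap R d l -> symw S p -> hprods l q -> H d (p * q).
Proof. by move=> ? ? ?; apply: sub_lspan; exists l, p, q. Qed.

Lemma hfil_symM d p r : symw S p -> H d r -> H d (p * r).
Proof.
move=> Sp; apply: (lspan_image (f := [the {linear P -> P} of mulp p])).
  exact: subspace_hfil.
move=> _ [l [p' [q [ld Sp' lq ->]]]]; rewrite /= /mulp mulrA.
by apply: (hfilI ld _ lq); apply: symwM.
Qed.

Lemma hcap_cons d i l : i \in R -> hcap R d l -> hcap R (d + delta_mx 0 i) (i :: l).
Proof.
move=> iR /andP [lR /forall_inP dl]; rewrite /hcap /= iR lR /=.
by apply/forall_inP => j jR /=; rewrite PoszD addrC !mxE /= [i == j]eq_sym lerD ?dl //; case: eqP.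
Qed.

Lemma hfil_hM d i a r : i \in R -> H d r -> H (d + delta_mx 0 i) (hs i a * r).
Proof.
move=> iR; apply: (lspan_image (f := [the {linear P -> P} of mulp (hs i a)])).
  exact: subspace_hfil.
move=> _ [l [p [q [ld Sp lq ->]]]]; rewrite /= /mulp mulrCA.
by apply: (hfilI _ Sp); [apply: hcap_cons ld | apply: hprods_cons].
Qed.

(** Concatenating lists of factors adds multiplicities, so capacities add. *)
Lemma hfilM d d' r r' : H d r -> H d' r' -> H (d + d') (r * r').
Proof.
move=> dr; apply: (lspan_image (f := [the {linear P -> P} of mulp r])).
  exact: subspace_hfil.
move=> _ [l' [p' [q' [ld' Sp' lq' ->]]]]; rewrite /= /mulp mulrC; move: r dr.
apply: (lspan_image (f := [the {linear P -> P} of mulp (p' * q')])).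
  exact: subspace_hfil.
move=> _ [l [p [q [ld Sp lq ->]]]]; rewrite /= /mulp mulrC mulrACA.
apply: (@hfilI _ (l ++ l')); [|exact: symwM|exact: hprodsM].
case/andP: ld ld' => lR /forall_inP ld /andP [lR' /forall_inP ld'].
rewrite /hcap all_cat lR lR' /=; apply/forall_inP => i iR.
by rewrite count_cat PoszD mxE lerD ?ld ?ld'.
Qed.

Lemma hfil1 d : (forall i, i \in R -> 0 <= d 0 i) -> H d 1.
Proof.
move=> d0; rewrite -[1]mulr1; apply: hfilI; [|exact: symw1|exact: hprods_nil].
by apply/forall_inP => i iR /=; apply: d0.
Qed.

Lemma hfil_der g d r : (forall x, x.1 \in S -> symw S (g x)) ->
    (forall i a, i \in R -> hprods [:: i] (pder g (hs i a))) ->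
  H d r -> H d (pder g r).
Proof.
move=> gS gR; apply: lspan_image; first exact: subspace_hfil.
move=> _ [l [p [q [ld Sp lq ->]]]]; rewrite pderM.
apply: (subspaceD (subspace_hfil _)).
  by apply: (hfilI ld _ lq); apply: symw_der.
apply: (hfilI ld Sp); apply: hprods_der => // i a il; apply: gR.
by case/andP: ld => /allP lR _; apply: lR.
Qed.

Lemma hfil_dann c k d r : H d r -> H d (dann c k r).
Proof.
apply: hfil_der => [x _|i a iR].
  case: ifP => _; last exact: lspan0.
  by apply: (subspaceZ _ (subspace_symw S)); exact: symw1.
rewrite [pder _ _](dann_hser charK0); case: ifP => _; last exact: lspan0.
apply: (subspaceZ _ (subspace_hprods _)).
by rewrite -[hs i _]mulr1; apply: hprods_cons; apply: hprods_nil.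
Qed.

Lemma hprods_aug i l q : hprods l q -> hprods (i :: l) q.
Proof. by move=> lq; rewrite -[q]mul1r -[1](hser0 P i); apply: hprods_cons. Qed.

Lemma hfil_eq d d' r : (forall i, i \in R -> d 0 i = d' 0 i) -> H d r -> H d' r.
Proof.
move=> dd'; apply: lspan_min => [|_ [l [p [q [ld Sp lq ->]]]]]; first exact: subspace_hfil.
apply: (@hfilI _ l) => //; case/andP: ld => lR /forall_inP ld; rewrite /hcap lR /=.
by apply/forall_inP => i iR; rewrite -dd' // ld.
Qed.

End Filtration.

(** * Which variables occur in H_d *)

Section FiltrationSupport.
Variables (K : fieldType) (charK0 : [pchar K] =i pred0) (n : nat).
Variable P : polyRing K ('I_n * nat)%type.
Implicit Types (p q : P) (R S : {set 'I_n}) (d : 'rV[int]_n).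

Lemma symw_sub S S' p : {subset S <= S'} -> symw S p -> symw S' p.
Proof.
move=> SS'; apply: lspan_min => [|_ [t tS ->]]; first exact: subspace_symw.
by apply: sub_lspan; exists t => //; apply: sub_all tS => x; apply: SS'.
Qed.

Lemma hfil_sub R S S' d p : {subset S <= S'} -> hfil R S d p -> hfil R S' d p.
Proof.
move=> SS'; apply: lspan_min => [|_ [l [q [r [ld Sq lr ->]]]]].
  exact: subspace_hfil.
by apply: (hfilI ld _ lr); apply: symw_sub Sq.
Qed.

Lemma symw_hser S i a : i \in S -> symw S (hser P i a).
Proof.
move=> iS; apply: (fexp_stable (U := symw S)) => [|j p Sp|]; first exact: subspace_symw.
  by apply: (subspaceZ _ (subspace_symw _ _)); apply: symw_varM.
exact: symw1.
Qed.

Lemma hfil_symw R d p : hfil R finset.set0 d p -> symw R p.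
Proof.
apply: lspan_min => [|_ [l [q [r [ld Sq lr ->]]]]]; first exact: subspace_symw.
apply: symwM; first by apply: symw_sub Sq => i; rewrite inE.
case/andP: ld => /allP lR _; move: lr.
apply: lspan_min => [|_ [t tl ->]]; first exact: subspace_symw.
rewrite -{}tl in lR; elim: t lR => [|x t IH] lR; first by rewrite big_nil; apply: symw1.
rewrite big_cons; apply: symwM; first by apply: symw_hser; apply: lR; apply: mem_head.
by apply: IH => i it; apply: lR; rewrite inE it orbT.
Qed.

End FiltrationSupport.

(** * Creation and annihilation exponentials, and weights *)

Section CreationAnnihilation.
Variables (K : fieldType) (charK0 : [pchar K] =i pred0) (n : nat).
Variable P : polyRing K ('I_n * nat)%type.
Implicit Types (p q : P) (i : 'I_n) (S : {set 'I_n}) (d : 'rV[int]_n).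
Local Notation var i k := (pvar P (i, k%N)).
Local Notation hs := (hser P).
Local Notation dtrans := (dtrans P).
Local Notation dann := (dann P).

Let natK0 k : k.+1%:R != 0 :> K.
Proof. by rewrite ((pcharf0P K).1 charK0). Qed.

(* The translation operator of V_L on M(1) (x) e^alpha, where a = alpha_(-1). *)
Definition ttrans (a p : P) : P := dtrans p + a * p.

Lemma ttrans_is_linear a : linear (ttrans a).
Proof. by move=> c p q; rewrite /ttrans linearP mulrDr -scalerAr scalerDr addrACA. Qed.
HB.instance Definition _ a :=
  GRing.isLinear.Build K P P _ (ttrans a) (ttrans_is_linear a).

Lemma ttransM a x p : ttrans a (pvar P x * p) =
  x.2.+1%:R *: (var x.1 x.2.+1 * p) + pvar P x * ttrans a p.
Proof.
rewrite /ttrans /dtrans pderXM -scalerAl mulrDr [a * _]mulrCA.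
by rewrite addrA.
Qed.

(** The coefficient of x^j in exp(x (T + a)). On 1, with a = alpha_(-1), it gives the creation part
    of Y(e^alpha, x), in a form that clearly preserves every [ttrans]-stable subspace. *)
Definition creat (a : P) j : P -> P := fun p => (j`!%:R)^-1 *: iter j (ttrans a) p.

Lemma creat_is_linear a j : linear (creat a j).
Proof.
move=> c p q; rewrite /creat.
have -> : iter j (ttrans a) (c *: p + q) =
    c *: iter j (ttrans a) p + iter j (ttrans a) q.
  by elim: j => [//|j IHj]; rewrite !iterS IHj linearP.
by rewrite scalerDr !scalerA [c * _]mulrC.
Qed.
HB.instance Definition _ a j :=
  GRing.isLinear.Build K P P _ (creat a j) (creat_is_linear a j).

Lemma creat0 a p : creat a 0 p = p.
Proof. by rewrite /creat invr1 scale1r. Qed.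

Lemma creatS a j p : j.+1%:R *: creat a j.+1 p = ttrans a (creat a j p).
Proof.
rewrite /creat scalerA factS natrM invfM mulrA mulfV // mul1r.
by rewrite linearZ.
Qed.

Lemma creatSr a j p : j.+1%:R *: creat a j.+1 p = creat a j (ttrans a p).
Proof.
by rewrite creatS /creat linearZ /= -iterSr.
Qed.

(** Conjugating beta_i(-k-1) by exp(x (T + a)) gives the creation part of the k-th divided
    derivative of beta_i(x). *)
Lemma creat_varM a i (k : nat) j p : creat a j (var i k * p) =
  \sum_(0 <= l < j.+1) 'C(k + l, k)%:R *: (var i (k + l) * creat a (j - l) p).
Proof.
elim: j p => [|j IH] p.
  by rewrite big_nat1 addn0 binn mulr1n scale1r subnn !creat0.
apply: (scalerI (natK0 j)); rewrite creatS IH linear_sum /=.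
transitivity (\sum_(0 <= l < j.+1) ('C(k + l, k) * (k + l).+1)%:R *:
      (var i (k + l).+1 * creat a (j - l) p) +
    \sum_(0 <= l < j.+1) ('C(k + l, k) * (j.+1 - l))%:R *:
      (var i (k + l) * creat a (j.+1 - l) p)).
  rewrite -big_split; apply: eq_big_nat => l /andP [_ lj] /=.
  rewrite linearZ /= ttransM /= -creatS scalerDr scalerA -natrM; congr (_ + _).
  by rewrite -scalerAr scalerA -natrM -subSn.
rewrite scaler_sumr.
(* The factor j + 1 splits as l + (j + 1 - l). The l-part is the first sum shifted by one, as C(k +
   l, k) (k + l + 1) = C(k + l + 1, k) (l + 1). *)
rewrite [in RHS](@eq_big_nat _ _ _ 0 j.+2 _
   (fun l => ('C(k + l, k) * l)%:R *: (var i (k + l) * creat a (j.+1 - l) p) +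
    ('C(k + l, k) * (j.+1 - l))%:R *: (var i (k + l) * creat a (j.+1 - l) p))).
  rewrite big_split /=; congr (_ + _); last first.
    by rewrite [RHS]big_nat_recr //= subnn muln0 scale0r addr0.
  rewrite [RHS]big_nat_recl // muln0 scale0r add0r; apply: eq_big_nat => l lj.
  rewrite subSS addnS; congr (_%:R *: _).
  rewrite mulnC; have := mul_bin_down (k + l).+1 k.
  by rewrite -addnS addKn /= addnS => ->; rewrite mulnC.
move=> l lj; rewrite -scalerDl -natrD scalerA -natrM; congr (_%:R *: _).
by rewrite -mulnDr subnKC 1?mulnC //; lia.
Qed.

(** This is the recursion of exp(sum_(j >= 1) a(-j) x^j / j), which therefore equals exp(x (T +
    a(-1))) 1. T kills 1, so one step T + a yields a, which [creat_varM] moves out. *)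
Lemma creat_newton (c : 'I_n -> K) j (a := \sum_i c i *: var i 0) :
  j%:R *: creat a j 1 =
  \sum_(0 <= l < j) (\sum_i c i *: var i l) * creat a (j - l.+1) 1.
Proof.
case: j => [|j]; first by rewrite big_geq // scale0r.
rewrite creatSr /ttrans /dtrans pder1 add0r mulr1 /a linear_sum /=.
transitivity (\sum_i \sum_(0 <= l < j.+1) c i *: var i l * creat a (j.+1 - l.+1) 1).
  apply: eq_bigr => i _; rewrite -[var i 0]mulr1 linearZ /= creat_varM scaler_sumr.
  by apply: eq_bigr => l _; rewrite add0n bin0 mulr1n scale1r scalerAl.
by rewrite exchange_big /=; apply: eq_bigr => l _; rewrite mulr_suml.
Qed.

Lemma creat_stable (U : set P) a j p : subspace U ->
  (forall q, U q -> U (ttrans a q)) -> U p -> U (creat a j p).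
Proof.
by move=> sU aU Up; apply: subspaceZ => //; elim: j => //= j; apply: aU.
Qed.

Lemma sum_varE (l : seq 'I_n) :
  \sum_(i <- l) var i 0 = \sum_i (count_mem i l)%:R *: var i 0.
Proof.
elim: l => [|j l IH]; first by rewrite big_nil big1 // => i _; rewrite scale0r.
rewrite big_cons IH /=; under [RHS]eq_bigr do rewrite natrD scalerDl.
rewrite big_split /=; congr (_ + _); rewrite (bigD1 j) //= eqxx scale1r big1 ?addr0 //.
by move=> i /negPf; rewrite eq_sym => ->; rewrite scale0r.
Qed.

(* Translation creates a new factor h_i(x) only when l has room for it: the   *)
(* coefficient of beta_i(-1) is then the unused capacity al_i - count_i l.    *)
Lemma hfil_ttrans (R S : {set 'I_n}) (al : 'rV[int]_n) r :
    (forall i, i \notin R -> i \notin S -> al 0 i = 0) ->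
  hfil R S al r -> hfil R S al (ttrans (\sum_i (al 0 i)%:~R *: var i 0) r).
Proof.
move=> al0; apply: lspan_image; first exact: subspace_hfil.
move=> _ [l [p [q [ld Sp lq ->]]]].
rewrite /= /ttrans (pderM _ p q : dtrans (p * q) = dtrans p * q + p * dtrans q).
have -> : dtrans p * q +
    p * dtrans q + (\sum_i (al 0 i)%:~R *: var i 0) * (p * q) =
    dtrans p * q +
    p * (dtrans q + (\sum_(i <- l) var i 0) * q) +
    \sum_i (al 0 i - (count_mem i l)%:Z)%:~R *: (p * (var i 0 * q)).
  have E2 : \sum_i (al 0 i - (count_mem i l)%:Z)%:~R *: (p * (var i 0 * q)) =
      \sum_i ((al 0 i)%:~R *: (p * (var i 0 * q)) -
        (count_mem i l)%:R *: (p * (var i 0 * q))).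
    by apply: eq_bigr => i _; rewrite intrB scalerBl.
  have E (c : 'I_n -> K) : \sum_i c i *: (p * (var i 0 * q)) =
      (\sum_i c i *: var i 0) * (p * q).
    by rewrite mulr_suml; apply: eq_bigr => i _; rewrite mulrCA scalerAl.
  rewrite E2 sumrB !E sum_varE; move: (dtrans p) (dtrans q) => u v; ring.
have /andP [/allP lR /forall_inP lal] := ld.
apply: (subspaceD (subspace_hfil _ _ _ _)); first apply: (subspaceD (subspace_hfil _ _ _ _)).
- apply: (hfilI ld _ lq); apply: symw_der => // x xS.
  apply: (subspaceZ _ (subspace_symw _ _)); rewrite -[pvar _ _]mulr1.
  by apply: symw_varM => //; apply: symw1.
- by apply: (hfilI ld Sp); apply: hprods_dtrans.
apply: (subspace_sum _ (subspace_hfil _ _ _ _)) => i _.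
have [iS|iNS] := boolP (i \in S).
  rewrite mulrA [p * _]mulrC; apply: (subspaceZ _ (subspace_hfil _ _ _ _)).
  by apply: (hfilI ld _ lq); apply: symw_varM.
have [iR|iNR] := boolP (i \in R); last first.
  rewrite al0 // (_ : count_mem i l = 0%N) ?subrr ?scale0r.
    by case: (subspace_hfil P R S al).
  by apply/eqP; rewrite -leqn0 leqNgt -has_count has_pred1; apply: contra iNR => /lR.
have [->|ne] := eqVneq (al 0 i) (count_mem i l)%:Z.
  by rewrite subrr scale0r; case: (subspace_hfil P R S al).
(* There is room for one more factor, and beta_i(-1) is h_(i,1). *)
apply: (subspaceZ _ (subspace_hfil _ _ _ _)); rewrite -(hser1 charK0).
apply: (@hfilI _ _ _ _ _ _ (i :: l)) => //; last exact: hprods_cons.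
rewrite /hcap /= iR (_ : all _ _ = true) /=; last exact/allP.
apply/forall_inP => j jR; have := lal j jR.
by case: eqP => [<-|_] //= le; rewrite PoszD lez1D lt_neqAle eq_sym ne.
Qed.

(** The annihilation exponential; [j.-1] appears because [dann c k] is the mode k + 1. *)
Definition aexp (c : 'I_n -> K) k : P -> P :=
  fexp (fun j p => - (j%:R)^-1 *: dann c j.-1 p) k.

Lemma aexp_is_linear c k : linear (aexp c k).
Proof.
apply: fexp_is_linear => j b u v; rewrite linearP scalerDr !scalerA.
by rewrite [b * _]mulrC.
Qed.
HB.instance Definition _ c k :=
  GRing.isLinear.Build K P P _ (aexp c k) (aexp_is_linear c k).

Lemma aexp0 c p : aexp c 0 p = p.
Proof. exact: fexp0. Qed.

Lemma hfil_aexp c k R S d r : hfil R S d r -> hfil R S d (aexp c k r).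
Proof.
apply: fexp_stable => [|j q Hq]; first exact: subspace_hfil.
by apply: (subspaceZ _ (subspace_hfil _ _ _ _)); apply: hfil_dann.
Qed.

Lemma hprods_aexp c k l q : hprods l q -> hprods l (aexp c k q).
Proof.
apply: (fexp_stable (U := hprods l)) => [|j r lr]; first exact: subspace_hprods.
apply: (subspaceZ _ (subspace_hprods _ _)); apply: hprods_der => // i a il.
rewrite [pder _ _](dann_hser charK0); case: ifP => _; last exact: lspan0.
apply: (subspaceZ _ (subspace_hprods _ _)).
by rewrite -[hs i _]mulr1; apply: hprods_cons; apply: hprods_nil.
Qed.

(** Both sides satisfy the same Newton recursion. Hence the creation part of Y(e^(beta_i), x) is
    h_i(x). *)
Lemma creat_hser i j : creat (var i 0) j 1 = hs i j.
Proof.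
move: j; apply: (eq_newton (o := fun k q => var i k * q) charK0) => [|j|j].
- by rewrite creat0 hser0.
- rewrite -[var i 0]scale1r.
  have := creat_newton (fun l => (l == i)%:R) j.
  have E k : \sum_l (l == i)%:R *: var l k = var i k.
    rewrite (bigD1 i) //= eqxx scale1r big1 ?addr0 // => l /negPf ->.
    by rewrite scale0r.
  by rewrite E scale1r => ->; apply: eq_bigr => k _; rewrite E.
- exact: hser_newton.
Qed.

Lemma aexp_dann c k c' k' p : dann c' k' (aexp c k p) = aexp c k (dann c' k' p).
Proof.
by rewrite /aexp; apply: fexp_morph => j q; rewrite linearZ /= dannC.
Qed.

(** The weight filtration, with beta_i(-k-1) of weight k + 1. The bound is an integer so that
    annihilation may push it below zero, which forces vanishing. *)
Definition wtle (w : int) : set P :=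
  lspan [set p | exists2 t, (\sum_(x <- t) x.2.+1)%N%:Z <= w &
    p = \prod_(x <- t) pvar P x].

Lemma subspace_wtle w : subspace (wtle w).
Proof. exact: subspace_lspan. Qed.

Lemma wtle_neg w p : w < 0 -> wtle w p -> p = 0.
Proof.
move=> w0; apply: (@lspan_min _ _ _ [set p | p = 0]).
  by split=> // c u v /= -> ->; rewrite scaler0 addr0.
by move=> _ [t tw ->]; have := le_lt_trans tw w0.
Qed.

Lemma wtle_exists p : exists w, wtle w p.
Proof.
have mono w w' q : w <= w' -> wtle w q -> wtle w' q.
  move=> ww'; apply: lspan_min => [|_ [t tw ->]]; first exact: subspace_wtle.
  by apply: sub_lspan; exists t => //; apply: le_trans ww'.
apply: (@pspan _ _ P [set p | exists w, wtle w p]) => [|t]; last first.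
  by exists (\sum_(x <- t) x.2.+1)%N%:Z; apply: sub_lspan; exists t.
split=> [|c u v [w wu] [w' wv]]; first by exists 0; apply: lspan0.
exists (Num.max w w'); apply: (subspaceD (subspace_wtle _)).
  by apply: (subspaceZ _ (subspace_wtle _)); apply: mono wu; rewrite le_max lexx.
by apply: mono wv; rewrite le_max lexx orbT.
Qed.

Lemma wtle_dann c k w p : wtle w p -> wtle (w - k.+1%:Z) (dann c k p).
Proof.
apply: lspan_image => [|_ [t tw ->]]; first exact: subspace_wtle.
elim: t w tw => [|x t IH] w; first by rewrite !big_nil [dann _ _ _]pder1 => _; apply: lspan0.
rewrite !big_cons PoszD => tw; rewrite [dann _ _ _]pderXM.
apply: (subspaceD (subspace_wtle _)).
  case: eqP => [xk|_]; last by rewrite mul0r; apply: lspan0.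
  rewrite mulr_algl; apply: (subspaceZ _ (subspace_wtle _)); apply: sub_lspan.
  by exists t => //; rewrite -xk lerBrDr addrC.
have := IH (w - x.2.+1%:Z); rewrite lerBrDl => /(_ tw).
apply: (lspan_image (f := [the {linear P -> P} of mulp (pvar P x)])).
  exact: subspace_wtle.
move=> _ [s sw ->]; apply: sub_lspan; exists (x :: s); last by rewrite big_cons.
by rewrite big_cons PoszD; move: sw; lia.
Qed.

Lemma wtle_aexp c k w p : wtle w p -> wtle (w - k%:Z) (aexp c k p).
Proof.
move=> wp; apply: (subspace_sum _ (subspace_wtle _)) => r _.
apply: (subspaceZ _ (subspace_wtle _)); move: (nat_of_ord r) => {r} r.
elim: r k => [|r IH] k /=.
  by case: eqP => [->|_]; [rewrite subr0 | apply: lspan0].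
rewrite big_add1 /= big_nat; apply: (subspace_sum _ (subspace_wtle _)) => j jk.
apply: (subspaceZ _ (subspace_wtle _)); have := @wtle_dann c j _ _ (IH (k - j.+1)%N).
by congr (wtle _ _); lia.
Qed.

Lemma aexp_1 c k : (0 < k)%N -> aexp c k 1 = 0 :> P.
Proof.
move=> k0; apply: (wtle_neg (w := 0 - k%:Z)); first by lia.
by apply: wtle_aexp; apply: sub_lspan; exists [::]; rewrite ?big_nil.
Qed.

Lemma aexp_c0 k p : (0 < k)%N -> aexp (fun=> 0) k p = 0 :> P.
Proof.
case: k => // k _; rewrite /aexp /fexp big1 // => -[[|r] rk] _ /=.
  by rewrite scaler0.
rewrite big_add1 big1 ?scaler0 // => j _.
rewrite (_ : dann _ _ _ = 0) ?scaler0 //.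
by rewrite dannE big1 // => i _; rewrite mulr0 scale0r.
Qed.

Lemma creat_0 j p : creat 0 j p = (j`!%:R)^-1 *: iter j dtrans p.
Proof.
by congr (_ *: _); elim: j => //= j ->; rewrite /ttrans mul0r addr0.
Qed.

Lemma creat_01 j : (0 < j)%N -> creat 0 j 1 = 0 :> P.
Proof.
case: j => // j _; rewrite creat_0 iterSr [dtrans 1]pder1 (_ : iter j _ 0 = 0) ?scaler0 //.
by elim: j => //= j ->; rewrite linear0.
Qed.

Lemma creat_0var i j : creat 0 j (var i 0) = var i j.
Proof.
rewrite -[var i 0]mulr1 creat_varM big_nat_recr //= big_nat big1 => [|l lj].
  by rewrite add0r add0n bin0 scale1r subnn creat0 mulr1.
by rewrite creat_01 ?mulr0 ?scaler0 //; lia.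
Qed.

End CreationAnnihilation.

(** * Modes as operators on polynomials *)

Section Fields.
Variables (K : fieldType) (charK0 : [pchar K] =i pred0) (n : nat).
Variable P : polyRing K ('I_n * nat)%type.
Local Notation var i k := (pvar P (i, k%N)).
Local Notation hs := (hser P).
Local Notation dann := (dann P).

Let natK0 k : k.+1%:R != 0 :> K.
Proof. by rewrite ((pcharf0P K).1 charK0). Qed.

(* The action of Y(p (x) e^al, x) on M(1) (x) e^b: gram is the Gram matrix,   *)
(* ac the pairing with al, zc the pairing with b, z = <al, b>, and e the      *)
(* cocycle factor. Sums over the annihilation index are cut off at N.         *)
Variables (gram : 'I_n -> 'I_n -> K) (ac zc : 'I_n -> K).
Variables (al : 'rV[int]_n) (z : int) (e : K) (N : nat).

Definition ann i j : P -> P := fun v =>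
  if j is k.+1 then dann (gram i) k v else zc i *: v.

Lemma ann_is_linear i j : linear (ann i j).
Proof.
case: j => [|k] c u v /=; last by rewrite linearP.
by rewrite scalerDr !scalerA mulrC.
Qed.
HB.instance Definition _ i j :=
  GRing.isLinear.Build K P P _ (ann i j) (ann_is_linear i j).

Lemma annC i j i' j' v : ann i j (ann i' j' v) = ann i' j' (ann i j v).
Proof.
case: j j' => [|k] [|k'] /=; rewrite ?linearZ //=; last exact: dannC.
by rewrite !scalerA mulrC.
Qed.

Lemma aexp_ann c k i j v : ann i j (aexp c k v) = aexp c k (ann i j v).
Proof.
case: j => [|j] /=; last exact: aexp_dann.
rewrite /aexp; apply: (fexp_morph (e := [the {linear P -> P} of ann i 0])) => j w.
by rewrite /= [in RHS]linearZ /= !scalerA mulrC.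
Qed.

Let acre : P := \sum_i (al 0 i)%:~R *: var i 0.

Definition creatz (x : int) (q : P) : P := if x is Posz k then creat acre k q else 0.

Lemma creatz_is_linear x : linear (creatz x).
Proof.
case: x => k c p q; last by rewrite /= scaler0 addr0.
exact: creat_is_linear.
Qed.
HB.instance Definition _ x :=
  GRing.isLinear.Build K P P _ (creatz x) (creatz_is_linear x).

Lemma creatz_neg x q : x < 0 -> creatz x q = 0.
Proof. by case: x. Qed.

Lemma creatz_varM x i (k B : nat) q : x + k%:Z < B%:Z -> creatz x (var i k * q) =
  \sum_(0 <= j < B) 'C(j, k)%:R *: (var i j * creatz (x + k%:Z - j%:Z) q).
Proof.
move=> xB; case: (ltrP x 0) => x0.
  rewrite creatz_neg // big1 // => j _; have [jk|kj] := ltnP j k.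
    by rewrite bin_small // scale0r.
  by rewrite creatz_neg ?mulr0 ?scaler0 //; lia.
case: x x0 xB => // x _ xB; rewrite /= creat_varM //.
rewrite [RHS](big_cat_nat (n := k)) //=; last by lia.
rewrite [X in X + _]big_nat [X in X + _]big1 ?add0r; last first.
  by move=> j jk; rewrite bin_small ?scale0r //; lia.
rewrite [RHS](big_cat_nat (n := (k + x.+1)%N)) //=; [|by lia|by lia].
rewrite [X in _ + X]big_nat [X in _ + X]big1 ?addr0; last first.
  by move=> j jk; rewrite creatz_neg ?mulr0 ?scaler0 //; lia.
rewrite -[X in _ = \sum_(X <= _ < _) _]add0n big_addn addKn; apply: eq_big_nat => l lx.
rewrite [(l + k)%N]addnC -[creat acre _ q]/(creatz (x - l)%N q).
by congr (_ *: (_ * creatz _ _)); lia.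
Qed.

Local Notation fieldT := (P -> P -> int -> P).

(** Y(e^al, x) acting on v, but with exp(x (T + al(-1))) applied to q instead of 1. Creation
    operators of further fields are stored in q as plain multiplications, so that factors can be
    counted there. *)
Definition fld0 : fieldT := fun v q m =>
  \sum_(0 <= p < N) creatz (p%:Z - z - m - 1) q * (e *: aexp ac p v).

Lemma fld0P c u v q m : fld0 (c *: u + v) q m = c *: fld0 u q m + fld0 v q m.
Proof.
rewrite /fld0 scaler_sumr -big_split; apply: eq_bigr => k _ /=.
by rewrite linearP scalerDr mulrDr -!scalerAr !scalerA [e * c]mulrC.
Qed.

Lemma fld0_v0 q m : fld0 0 q m = 0.
Proof.
by rewrite /fld0 big1 // => k _; rewrite linear0 scaler0 mulr0.
Qed.

Definition lfld (r : P) (f : fieldT) : fieldT := fun v q m => f v (r * q) m.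

Definition rfld (x : 'I_n * nat) (f : fieldT) : fieldT := fun v q m =>
  \sum_(0 <= j < N) ((-1) ^+ x.2 * 'C(j + x.2, x.2)%:R) *:
    f (ann x.1 j v) q (m - j%:Z - x.2.+1%:Z).

(** Normally ordered product with a divided derivative of beta_i(x): the creation half goes into q,
    the annihilation half acts on v. *)
Definition dfld x f := lfld (pvar P x) f + rfld x f.

Lemma rfldP x c (f g : fieldT) v q m :
  rfld x (c *: f + g) v q m = c *: rfld x f v q m + rfld x g v q m.
Proof.
rewrite /rfld scaler_sumr -big_split; apply: eq_bigr => j _ /=.
have -> : (c *: f + g) (ann x.1 j v) q (m - j%:Z - x.2.+1%:Z) =
  c *: f (ann x.1 j v) q (m - j%:Z - x.2.+1%:Z) +
  g (ann x.1 j v) q (m - j%:Z - x.2.+1%:Z) by [].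
by rewrite scalerDr !scalerA [c * _]mulrC.
Qed.

Lemma rfld_is_linear x : linear (rfld x).
Proof.
move=> c f g; apply/funext => v; apply/funext => q; apply/funext => m.
exact: rfldP.
Qed.
HB.instance Definition _ x :=
  GRing.isLinear.Build K fieldT fieldT _ (rfld x) (rfld_is_linear x).

Lemma dfld_is_linear x : linear (dfld x).
Proof.
move=> c f g; apply/funext => v; apply/funext => q; apply/funext => m.
have -> : dfld x (c *: f + g) v q m = c *: f v (pvar P x * q) m +
  g v (pvar P x * q) m + rfld x (c *: f + g) v q m by [].
have -> : (c *: dfld x f + dfld x g) v q m =
  c *: (f v (pvar P x * q) m + rfld x f v q m) +
  (g v (pvar P x * q) m + rfld x g v q m) by [].
by rewrite rfldP scalerDr addrACA.
Qed.
HB.instance Definition _ x :=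
  GRing.isLinear.Build K fieldT fieldT _ (dfld x) (dfld_is_linear x).

Lemma rfldC x y f : rfld x (rfld y f) = rfld y (rfld x f).
Proof.
apply/funext => v; apply/funext => q; apply/funext => m.
rewrite /rfld; under eq_bigr do rewrite scaler_sumr.
rewrite exchange_big; apply: eq_bigr => j _ /=; rewrite scaler_sumr.
apply: eq_bigr => l _; rewrite !scalerA mulrC annC; congr (_ *: f _ _ _).
by lia.
Qed.

(** The halves acting on q and on v commute, and so do the annihilation operators. Thus [fld]
    depends only on the monomial of a word and extends to polynomials. *)
Lemma dfldC x y f : dfld x (dfld y f) = dfld y (dfld x f).
Proof.
have E x' y' v q m : dfld x' (dfld y' f) v q m =
    f v (pvar P y' * (pvar P x' * q)) m + rfld x' (rfld y' f) v q m +
    (rfld y' f v (pvar P x' * q) m + rfld x' f v (pvar P y' * q) m).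
  have -> : dfld x' (dfld y' f) v q m =
      f v (pvar P y' * (pvar P x' * q)) m + rfld y' f v (pvar P x' * q) m +
      rfld x' (dfld y' f) v q m by [].
  have -> : rfld x' (dfld y' f) v q m =
      rfld x' f v (pvar P y' * q) m + rfld x' (rfld y' f) v q m.
    by rewrite -big_split; apply: eq_bigr => j _; apply: scalerDr.
  by rewrite -!addrA; congr (_ + _); rewrite addrA addrC.
apply/funext => v; apply/funext => q; apply/funext => m.
rewrite !E rfldC mulrCA; congr (_ + _); exact: addrC.
Qed.

Definition fld s : fieldT := foldr dfld fld0 s.

Lemma fld_perm s t : perm_eq s t -> fld s = fld t.
Proof.
have swap x s1 s2 : fld (s1 ++ x :: s2) = fld (x :: s1 ++ s2).
  by elim: s1 => //= y s1 IH; rewrite IH dfldC.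
elim: s t => [|x s IH] t st.
  by move: st; rewrite perm_sym => /perm_nilP ->.
have xt : x \in t by rewrite -(perm_mem st) mem_head.
case/splitPr: xt st => t1 t2; rewrite perm_sym perm_catC cat_cons perm_cons => st.
rewrite swap /=; congr (dfld x _); apply: IH.
by rewrite perm_sym perm_catC.
Qed.

Lemma fldhat_ex : exists F : {linear P -> fieldT},
  forall t, F (\prod_(x <- t) pvar P x) = fld t.
Proof. exact: (pext P fld_perm). Qed.

Definition fldhat : {linear P -> fieldT} := sval (cid fldhat_ex).

Lemma fldhat_prod t : fldhat (\prod_(x <- t) pvar P x) = fld t.
Proof. exact: (svalP (cid fldhat_ex)). Qed.

Lemma fldhat1 : fldhat 1 = fld0.
Proof. by have := fldhat_prod [::]; rewrite big_nil. Qed.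

Lemma fldhat_varM x p : fldhat (pvar P x * p) = dfld x (fldhat p).
Proof.
pose f := [the {linear P -> fieldT} of fldhat \o mulp (pvar P x)].
pose f' := [the {linear P -> fieldT} of dfld x \o fldhat].
suff: f =1 f' by apply.
apply: plinearP => t.
have fE : f (\prod_(y <- t) pvar P y) = fld (x :: t).
  by rewrite -fldhat_prod big_cons.
have fE' : f' (\prod_(y <- t) pvar P y) = dfld x (fld t) by rewrite -fldhat_prod.
by rewrite fE fE'.
Qed.

Definition qlin (f : fieldT) := forall v m c q q',
  f v (c *: q + q') m = c *: f v q m + f v q' m.

Lemma subspace_qlin : subspace [set f | qlin f].
Proof.
split=> [v m c q q'|c f g lf lg v m c' q q'].
  by rewrite -[LHS]/(0 : P) -[RHS]/(c *: (0 : P) + 0) scaler0 addr0.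
rewrite -[LHS]/(c *: f v (c' *: q + q') m + g v (c' *: q + q') m).
rewrite -[RHS]/(c' *: (c *: f v q m + g v q m) + (c *: f v q' m + g v q' m)).
rewrite lf lg !scalerDr !scalerA [c * _]mulrC -!addrA; congr (_ + _).
by rewrite addrCA.
Qed.

Lemma qlin_rfld x f : qlin f -> qlin (rfld x f).
Proof.
move=> lf v m c q q'; rewrite /rfld scaler_sumr -big_split.
by apply: eq_bigr => j _; rewrite lf scalerDr !scalerA [c * _]mulrC.
Qed.

Lemma qlin_fldhat p : qlin (fldhat p).
Proof.
apply: (lspan_image (f := fldhat) (A := [set p | exists t, p = \prod_(x <- t) pvar P x])).
- exact: subspace_qlin.
- move=> _ [t ->]; rewrite /= fldhat_prod; elim: t => [|x t IH] v m c q q'.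
    rewrite /fld /= /fld0 scaler_sumr -big_split; apply: eq_bigr => j _.
    by rewrite linearP mulrDl scalerAl.
  rewrite -[LHS]/(fld t v (pvar P x * (c *: q + q')) m + rfld x (fld t) v (c *: q + q') m).
  rewrite qlin_rfld // mulrDr -scalerAr IH.
  rewrite -[fld (x :: t) v q m]/(fld t v (pvar P x * q) m + rfld x (fld t) v q m).
  rewrite -[fld (x :: t) v q' m]/(fld t v (pvar P x * q') m + rfld x (fld t) v q' m).
  by rewrite scalerDr addrACA.
- apply: (@pspan _ _ P); first exact: subspace_lspan.
  by move=> t; apply: sub_lspan; exists t.
Qed.

Lemma qlin_sum f v m I (r : seq I) (F : I -> P) : qlin f ->
  f v (\sum_(i <- r) F i) m = \sum_(i <- r) f v (F i) m.
Proof.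
move=> lf; have f0 : f v 0 m = 0 by have := lf v m (-1) 0 0; rewrite scaler0 addr0 scaleN1r addNr.
elim: r => [|i r IH]; first by rewrite !big_nil f0.
by rewrite !big_cons -IH; have := lf v m 1 (F i) (\sum_(j <- r) F j); rewrite !scale1r.
Qed.

Lemma qlinZ f v m c q : qlin f -> f v (c *: q) m = c *: f v q m.
Proof.
move=> lf; have f0 : f v 0 m = 0 by have := lf v m (-1) 0 0; rewrite scaler0 addr0 scaleN1r addNr.
by have := lf v m c q 0; rewrite f0 !addr0.
Qed.

(** [hser] with multiplication by [var i k] replaced by the operator [rfld (i, k)]. *)
Definition rser i r (f : fieldT) : fieldT :=
  fexp (fun j f => (j%:R)^-1 *: rfld (i, j.-1) f) r f.

Lemma rser_newton i r f v q m : r%:R *: rser i r f v q m =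
  \sum_(0 <= k < r) rfld (i, k) (rser i (r - k.+1) f) v q m.
Proof.
have evE (I : Type) (s : seq I) (F : I -> fieldT) :
    (\sum_(j <- s) F j) v q m = \sum_(j <- s) F j v q m.
  elim: s => [|j s IH]; first by rewrite !big_nil.
  by rewrite !big_cons -IH.
have := fexp_newton charK0 (fun j => (j%:R)^-1)
  (o := fun j => [the {linear fieldT -> fieldT} of rfld (i, j.-1)])
  (fun j k f => rfldC _ _ f) r f.
move/(congr1 (fun g : fieldT => g v q m)); rewrite evE => E.
apply: (etrans E); apply: eq_bigr => k _ /=.
pose g := rfld (i, k) (rser i (r - k.+1) f) v q m.
rewrite -[LHS]/(k.+1%:R *: (k.+1%:R^-1 *: g)) -[RHS]/g.
by rewrite scalerA mulfV // scale1r.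
Qed.

(** beta_i(-k-1) acts on fields as a sum of commuting operators, one on q and one on v, so h_i(x)
    acts as a product of two exponentials, the one on q being multiplication by h_i(x). Hence q
    gains a single coefficient of h_i. *)
Lemma fldhat_hser i a p v q m : fldhat (hs i a * p) v q m =
  \sum_(0 <= r < a.+1) rser i r (fldhat p) v (hs i (a - r) * q) m.
Proof.
have evE (I : Type) (s : seq I) (F : I -> fieldT) w r l :
    (\sum_(j <- s) F j) w r l = \sum_(j <- s) F j w r l.
  elim: s => [|j s IH]; first by rewrite !big_nil.
  by rewrite !big_cons -IH.
elim/ltn_ind: a v q m => -[|a] IH v q m.
  by rewrite big_nat1 subnn hser0 !mul1r /rser fexp0.
have lg r : qlin (rser i r (fldhat p)).
  apply: (fexp_stable (U := [set f | qlin f])); first exact: subspace_qlin.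
    by move=> j w lw; apply: (subspaceZ _ subspace_qlin); apply: qlin_rfld.
  exact: qlin_fldhat.
apply: (scalerI (natK0 a)).
rewrite -[LHS]/((a.+1%:R *: fldhat (hs i a.+1 * p)) v q m) -linearZ /= scalerAl.
rewrite (hser_newton charK0) mulr_suml linear_sum evE.
transitivity (\sum_(0 <= k < a.+1) (\sum_(0 <= r < a.+1 - k)
    rser i r (fldhat p) v (var i k * hs i (a - k - r) * q) m +
   \sum_(0 <= r < a.+1 - k)
      rfld (i, k) (rser i r (fldhat p)) v (hs i (a - k - r) * q) m)).
  apply: eq_big_nat => k /andP [_ ka]; rewrite -mulrA fldhat_varM.
  rewrite -[LHS]/(fldhat (hs i (a.+1 - k.+1) * p) v (var i k * q) m +
     rfld (i, k) (fldhat (hs i (a.+1 - k.+1) * p)) v q m) subSS.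
  have ak : (a - k < a.+1)%N by rewrite ltnS leq_subr.
  rewrite IH // -subSn //; congr (_ + _).
    by apply: eq_bigr => r _; rewrite mulrCA mulrA.
  rewrite {1}/rfld; under eq_bigr => j _ do rewrite IH // -subSn // scaler_sumr.
  by rewrite exchange_big /=.
pose g r := rser i r (fldhat p) v (hs i (a.+1 - r) * q) m.
rewrite big_split /=.
(* Newton's identity for [hser] collapses the first double sum, that for [rser] the second; the
   factors a + 1 - r and r add up to a + 1. *)
transitivity (\sum_(0 <= r < a.+1) (a.+1 - r)%:R *: g r +
    \sum_(0 <= s < a.+1) s.+1%:R *: g s.+1).
  congr (_ + _).
    (* At [a.+2] the inner bounds are [a.+1 - k], as required, and the last outer term is an empty
       sum. *)
    have := @sum_triangle P a.+2
      (fun r k => rser i r (fldhat p) v (var i k * hs i (a - k - r) * q) m).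
    rewrite big_nat_recr //= subnn [X in _ + X]big_geq // addr0 => E.
    apply: (etrans E).
    rewrite big_nat_recr //= subnn [X in _ + X]big_geq // addr0.
    apply: eq_big_nat => r /andP [_ ra].
    rewrite subSS /g -(qlinZ _ _ _ _ (lg r)) scalerAl (hser_newton charK0) mulr_suml.
    rewrite (qlin_sum _ _ _ _ (lg r)); apply: eq_big_nat => k /andP [_ kr].
    by congr (rser _ _ _ _ (_ * hs _ _ * _) _); lia.
  rewrite sum_diag; apply: eq_big_nat => s /andP [_ sa].
  rewrite /g rser_newton; apply: eq_big_nat => k /andP [_ ks].
  by congr (rfld _ (rser _ _ _) _ (hs _ _ * _) _); lia.
rewrite [RHS]scaler_sumr.
transitivity (\sum_(0 <= r < a.+2) ((a.+1 - r)%:R *: g r + r%:R *: g r)).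
  rewrite big_split /=; congr (_ + _).
    by rewrite [RHS]big_nat_recr //= subnn scale0r addr0.
  by rewrite [RHS]big_nat_recl // scale0r add0r.
by apply: eq_big_nat => r ra; rewrite -scalerDl -natrD subnK //; lia.
Qed.

(** * Stability of the H_d under all modes *)

Section Closure.
Variables (R S : {set 'I_n}) (d : 'rV[int]_n).
Local Notation H := (hfil R S).

(** The index c is the capacity left for q once the factors h_i of the field have claimed their
    share of al. *)
Definition fldfil (c : 'rV[int]_n) : set fieldT :=
  [set f | forall v q m, H d v -> H c q -> H (d + al) (f v q m)].

Lemma subspace_fldfil c : subspace (fldfil c).
Proof.
split=> [v q m _ _|b f g Hf Hg v q m Hv Hq].
  by rewrite -[X in H _ X]/(0 : P); case: (subspace_hfil P R S (d + al)).
rewrite -[X in H _ X]/(b *: f v q m + g v q m).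
by case: (subspace_hfil P R S (d + al)) => _; apply; [apply: Hf | apply: Hg].
Qed.

Lemma hfil_ann i j v : H d v -> H d (ann i j v).
Proof.
move=> Hv; case: j => [|j]; last exact: hfil_dann.
exact: (subspaceZ _ (subspace_hfil _ _ _ _)).
Qed.

Lemma fldfil_rfld x c f : fldfil c f -> fldfil c (rfld x f).
Proof.
move=> Hf v q m Hv Hq; apply: (subspace_sum _ (subspace_hfil _ _ _ _)) => j _.
by apply: (subspaceZ _ (subspace_hfil _ _ _ _)); apply: Hf => //; apply: hfil_ann.
Qed.

Hypothesis al0 : forall i, i \notin R -> i \notin S -> al 0 i = 0.

(** T + al(-1) preserves H_al by [hfil_ttrans], hence so does its exponential; annihilation
    preserves H_d, and capacities add. *)
Lemma fldfil_fld0 : fldfil al fld0.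
Proof.
move=> v q m Hv Hq; apply: (subspace_sum _ (subspace_hfil _ _ _ _)) => p _.
rewrite addrC; apply: hfilM; last first.
  by apply: (subspaceZ _ (subspace_hfil _ _ _ _)); apply: hfil_aexp.
case: (_ - 1) => k /=; last by case: (subspace_hfil P R S al).
apply: (creat_stable (U := H al)) => [|r Hr|//]; first exact: subspace_hfil.
exact: hfil_ttrans.
Qed.

Lemma fldfil_var x c p : x.1 \in S -> fldfil c (fldhat p) ->
  fldfil c (fldhat (pvar P x * p)).
Proof.
move=> xS Hp; rewrite fldhat_varM => v q m Hv Hq.
rewrite -[X in H _ X]/(fldhat p v (pvar P x * q) m + rfld x (fldhat p) v q m).
apply: (subspaceD (subspace_hfil _ _ _ _)); last exact: (@fldfil_rfld x c _ Hp v q m Hv Hq).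
apply: Hp => //; apply: hfil_symM => //.
by rewrite -[pvar P x]mulr1; apply: symw_varM => //; apply: symw1.
Qed.

Lemma fldfil_hser i a c p : i \in R -> fldfil (c + delta_mx 0 i) (fldhat p) ->
  fldfil c (fldhat (hs i a * p)).
Proof.
move=> iR Hp v q m Hv Hq; rewrite fldhat_hser.
apply: (subspace_sum _ (subspace_hfil _ _ _ _)) => r _.
suff Hg : fldfil (c + delta_mx 0 i) (rser i r (fldhat p)).
  exact: (Hg v (hs i (a - r) * q) m Hv (hfil_hM _ iR Hq)).
apply: (fexp_stable (U := fldfil (c + delta_mx 0 i))) => [|j w Hw|//].
  exact: subspace_fldfil.
by apply: (subspaceZ _ (subspace_fldfil _)); apply: fldfil_rfld.
Qed.

(** The factors of r listed in [l] use part of the capacity al. The rest is nonnegative on R, so its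
    space contains 1, the polynomial at which the field is evaluated. *)
Lemma hfil_fldhat r v m : H al r -> H d v -> H (d + al) (fldhat r v 1 m).
Proof.
move=> Hr Hv; move: r Hr.
have sU : subspace [set r : P | H (d + al) (fldhat r v 1 m)].
  split=> [|c r r' Hr Hr'] /=.
    rewrite linear0 -[X in H _ X]/(0 : P).
    by case: (subspace_hfil P R S (d + al)).
  rewrite linearP -[X in H _ X]/(c *: fldhat r v 1 m + fldhat r' v 1 m).
  by case: (subspace_hfil P R S (d + al)) => _; apply.
apply: lspan_min => // _ [l [p [q [ld Sp lq ->]]]] /=.
have cnt i : i \in R -> 0 <= (al - \sum_(j <- l) delta_mx 0 j) 0 i.
  move=> iR; case/andP: ld => _ /forall_inP /(_ i iR); rewrite !mxE summxE subr_ge0.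
  congr (_ <= _); elim: l {lq} => [|j l IH]; rewrite ?big_nil // big_cons -IH.
  by rewrite /= PoszD mxE eqxx /= natz eq_sym.
suff : fldfil (al - \sum_(j <- l) delta_mx 0 j) (fldhat (p * q)).
  by apply => //; apply: hfil1.
rewrite mulrC.
have lR : {subset l <= R} by case/andP: ld => /allP.
have base : fldfil (al - \sum_(j <- l) delta_mx 0 j) (fldhat q).
  move: q lq; apply: lspan_image => [|_ [t tl ->]]; first exact: subspace_fldfil.
  have {}lR : {subset map fst t <= R} by rewrite tl.
  rewrite -tl {cnt ld tl}.
  elim: t lR => [|[i a] t IH] lR; first by rewrite !big_nil subr0 fldhat1; apply: fldfil_fld0.
  rewrite [map _ _]/= !big_cons; apply: fldfil_hser; first by apply: lR; apply: mem_head.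
  rewrite opprD addrA addrAC addrNK; apply: IH.
  by move=> j jt; apply: lR; rewrite inE jt orbT.
move: p Sp; apply: (lspan_image
  (f := [the {linear P -> fieldT} of fldhat \o [the {linear P -> P} of mulp q]])).
  exact: subspace_fldfil.
move=> _ [t tS ->]; rewrite [X in fldfil _ X]/(fldhat (q * \prod_(x <- t) pvar P x)).
elim: t tS => [|x t IH]; first by rewrite big_nil mulr1.
by rewrite big_cons mulrCA => /andP [xS tS]; apply: fldfil_var => //; apply: IH.
Qed.

End Closure.

(** * Vanishing of high modes *)

Section Truncation.

(** The pure exponential vanishes for m >= N - z, and a factor (i, k) lowers m by at most N + k. *)
Definition fldbound (s : seq ('I_n * nat)) : int :=
  foldr (fun x M => M + N%:Z + x.2.+1%:Z) (N%:Z - z) s.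

Lemma fld_cons x s v q m :
  fld (x :: s) v q m = fld s v (pvar P x * q) m + rfld x (fld s) v q m.
Proof. by []. Qed.

Lemma fld_trunc s v q m : fldbound s <= m -> fld s v q m = 0.
Proof.
elim: s v q m => [|x s IH] v q m sm; rewrite /= in sm.
  rewrite [LHS]/(fld0 v q m) /fld0 big_nat big1 // => p pN.
  by rewrite creatz_neg ?mul0r //; lia.
rewrite fld_cons IH ?add0r; last by lia.
rewrite /rfld big_nat big1 // => j jN; rewrite IH ?scaler0 //; lia.
Qed.

(** Turns a creation operator stored in q back into the sum of creation operators on the left that
    [nop] uses; the bound puts all nonzero terms below B. *)
Lemma fld_varM s v i (k B : nat) q m : fldbound s <= m + B%:Z - k%:Z ->
  fld s v (var i k * q) m =
  \sum_(0 <= j < B) 'C(j, k)%:R *: (var i j * fld s v q (m + j%:Z - k%:Z)).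
Proof.
elim: s v q m => [|x s IH] v q m sm; rewrite /= in sm.
  rewrite -[LHS]/(\sum_(0 <= p < N) creatz (p%:Z - z - m - 1) (var i k * q) *
    (e *: aexp ac p v)).
  under [RHS]eq_bigr => j _ do rewrite -[fld _ _ _ _]/(fld0 v q _) /fld0 mulr_sumr scaler_sumr.
  rewrite exchange_big /=; apply: eq_big_nat => p pN.
  rewrite (@creatz_varM _ i k B) ?mulr_suml; last by lia.
  apply: eq_bigr => j _; rewrite -scalerAl mulrA; congr (_ *: (_ * creatz _ _ * _)).
  by lia.
rewrite fld_cons mulrCA IH; last by lia.
under [RHS]eq_bigr => j _ do rewrite fld_cons mulrDr scalerDr.
rewrite big_split /=; congr (_ + _); rewrite /rfld.
under [RHS]eq_bigr => j _ do rewrite mulr_sumr scaler_sumr.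
rewrite exchange_big /=; apply: eq_big_nat => j jN.
rewrite IH ?scaler_sumr; last by lia.
apply: eq_bigr => l _; rewrite -scalerAr !scalerA mulrC.
by congr (_ *: (_ * fld _ _ _ _)); lia.
Qed.

End Truncation.

End Fields.

(** * The modes used for generation *)

Section ChargeZero.
Variables (K : fieldType) (charK0 : [pchar K] =i pred0) (n : nat).
Variable P : polyRing K ('I_n * nat)%type.
Local Notation var i k := (pvar P (i, k%N)).

(** At charge zero both exponentials are trivial, so negative modes of beta_i(-1) are creation
    operators; the annihilation half drops out because T kills 1. *)
Lemma fld_charge0 gram (zc : 'I_n -> K) N i j (p : P) : (0 < N)%N ->
  fld gram (fun=> 0) zc 0 0 1 N [:: (i, 0%N)] p 1 (Negz j) = var i j * p.
Proof.
move=> N0; have f0 v q m :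
    fld0 (fun=> 0) 0 0 1 N v q m = creatz 0 (- m - 1) q * v :> P.
  rewrite /fld0 big_ltn // big_nat big1 ?addr0 => [|k k0].
    by rewrite scale1r aexp0; congr (creatz _ _ _ * _); lia.
  by rewrite aexp_c0 ?scaler0 ?mulr0 //; lia.
have a0 : \sum_i ((0 : 'rV[int]_n) 0 i)%:~R *: var i 0 = 0.
  by rewrite big1 // => l _; rewrite mxE scale0r.
rewrite fld_cons [fld _ _ _ _ _ _ _ _ _ _ _]f0 /rfld big1 ?addr0 => [|l _].
  rewrite mulr1 (_ : - Negz j - 1 = j) /creatz ?a0 ?creat_0var //; last by lia.
rewrite [fld _ _ _ _ _ _ _ _ _ _ _]f0 (_ : _ - 1 = (j + l + 1)%N%:Z) /creatz ?a0.
  by rewrite creat_01 ?mul0r ?scaler0 // addn1.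
by rewrite /=; lia.
Qed.

(** In this mode the creation exponent is a + k when annihilation takes k. The term k = 0 is the
    wanted one; the others involve polynomials of lower weight. *)
Lemma fld0_hser ac i z e N a (q : P) :
  fld0 ac (delta_mx 0 i) z e N.+1 q 1 (- z - 1 - a%:Z) =
    e *: (hser P i a * q) +
    \sum_(1 <= k < N.+1) hser P i (a + k) * (e *: aexp ac k q).
Proof.
have ai : \sum_j ((delta_mx 0 i : 'rV[int]_n) 0 j)%:~R *: var j 0 = var i 0.
  rewrite (bigD1 i) //= mxE !eqxx scale1r big1 ?addr0 // => l /negPf li.
  by rewrite mxE li andbF scale0r.
have cE k : creatz (delta_mx 0 i) (k%:Z - z - (- z - 1 - a%:Z) - 1) 1 =
    hser P i (a + k).
  rewrite (_ : _ - 1 = (a + k)%N%:Z); last by lia.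
  by rewrite /creatz ai creat_hser.
rewrite /fld0 big_ltn // aexp0 cE addn0 -scalerAr; congr (_ + _).
by apply: eq_bigr => k _; rewrite cE.
Qed.

End ChargeZero.

(** * Finitely supported sums over infinite index sets *)

Lemma fsum_seq (X : nmodType) (I : choiceType) (A : set I) (r : seq I) (F : I -> X) :
  uniq r -> [set` r] `<=` A -> (forall i, A i -> i \notin r -> F i = 0) ->
  \sum_(i \in A) F i = \sum_(i <- r) F i.
Proof.
move=> ru rA F0; rewrite (fsbigE r) // big_seq_cond [RHS]big_seq.
by apply: eq_bigl => i; case ir: (i \in r) => //=; apply/mem_set/rA.
Qed.

Lemma fsum_nat (X : nmodType) (F : nat -> X) B :
  (forall j, (B <= j)%N -> F j = 0) ->
  \sum_(j \in [set: nat]) F j = \sum_(0 <= j < B) F j.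
Proof.
move=> F0; apply: fsum_seq => //; first exact: iota_uniq.
by move=> j _; rewrite mem_index_iota /= -leqNgt; apply: F0.
Qed.

(* The pairs (k1, k2) are the exponents of the creation and annihilation      *)
(* parts of Y(e^al, x) contributing to the coefficient of x^(-m-1).           *)
Lemma fsum_modes (X : nmodType) (F : nat -> nat -> X) (x : rat) (z m : int) N :
  x = z%:~R -> (forall j k, (N <= k)%N -> F j k = 0) ->
  \sum_(p \in [set p : (nat * nat)%type |
      p.1%:R - p.2%:R + x = - m%:~R - 1 :> rat]) F p.1 p.2 =
  \sum_(0 <= k < N) if k%:Z - z - m - 1 is Posz j then F j k else 0.
Proof.
move=> -> F0.
pose r := [seq (absz (k%:Z - z - m - 1)%R, k) | k <- iota 0 N & 0 <= k%:Z - z - m - 1].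
have eqZ (j k : nat) : (j%:R - k%:R + z%:~R == - m%:~R - 1 :> rat) =
    (j%:Z == k%:Z - z - m - 1).
  rewrite -subr_eq0 -[in RHS]subr_eq0 -(intr_eq0 rat).
  rewrite !(rmorphB, rmorphD, rmorphN) /= !pmulrn.
  by congr (_ == 0); ring.
rewrite (fsum_seq (r := r)).
- rewrite big_map big_filter big_mkcond /= /index_iota subn0.
  by apply: eq_bigr => k _; case: (_ - 1).
- rewrite map_inj_uniq ?filter_uniq ?iota_uniq //.
  by move=> k l [_ ->].
- move=> y /= /mapP [k]; rewrite mem_filter => /andP [k0 _] -> /=.
  by apply/eqP; rewrite eqZ; apply/eqP; rewrite gez0_abs.
- move=> [j k] /= /eqP; rewrite eqZ => /eqP jk jkr; apply: F0.
  rewrite leqNgt; apply: contra jkr => kN; apply/mapP; exists k.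
    by rewrite mem_filter -jk /= mem_iota.
  by rewrite -jk.
Qed.

(** * The concrete Fock space and its copies p (x) e^b *)

Section FockRing.
Variables (K : fieldType) (I : choiceType).
Local Notation P := {malg K[{cmonom I}]}.

Fact fock_span (U : set P) : subspace U ->
  (forall t, U (\prod_(x <- t) var K x)) -> forall p, U p.
Proof. by move=> sU UP p; apply: subspace_vprod => // t; rewrite vprodE. Qed.

Fact fock_ext (X : lmodType K) (f : seq I -> X) :
  (forall s t, perm_eq s t -> f s = f t) ->
  exists g : {linear P -> X}, forall t, g (\prod_(x <- t) var K x) = f t.
Proof.
move=> fP; exists [the {linear P -> X} of linext (fun m => f (mword m))] => t.
by rewrite /= -vprodE linext_vprod.
Qed.

Definition fockR : polyRing K I := @PolyRing K I P (@var K I)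
  (fun g => [the {linear P -> P} of deriv g]) fock_span fock_ext
  (@deriv1 K I) (@derivXM K I).

End FockRing.

Section Embedding.
Variables (K : fieldType) (n : nat) (G : 'M[int]_n).
Local Notation mon := {cmonom ('I_n * nat)%type}.
Local Notation M := {malg K[mon]}.
Local Notation P := (fockR K ('I_n * nat)%type).
Local Notation V := (VLdual K G).
Local Notation var i k := (pvar P (i, k%N)).

Definition emb (b : dual G) (p : P) : V := linext (fun m : mon => bvec K m b) (p : M).

Lemma emb_is_linear b : linear (emb b).
Proof. exact: (@linext_is_linear K mon V). Qed.
HB.instance Definition _ b :=
  GRing.isLinear.Build K P V _ (emb b) (emb_is_linear b).

Lemma embZ b c (p : P) : emb b (c *: p) = c *: emb b p.
Proof. exact: linearZ. Qed.

Lemma embD b (p q : P) : emb b (p + q) = emb b p + emb b q.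
Proof. exact: linearD. Qed.

Lemma emb_sum b (I : Type) (s : seq I) (F : I -> P) :
  emb b (\sum_(i <- s) F i) = \sum_(i <- s) emb b (F i).
Proof. exact: linear_sum. Qed.

Lemma embU b (m : mon) : emb b (<< m >> : M) = bvec K m b.
Proof. exact: linextU. Qed.

Lemma emb1 b : emb b 1 = ee K b.
Proof. exact: embU. Qed.

Lemma emb_prod b t : emb b (\prod_(x <- t) pvar P x) = bvec K (mprod t) b.
Proof.
have <- : vprod K t = \prod_(x <- t) pvar P x by exact: vprodE.
exact: embU.
Qed.

Lemma fock_word (m : mon) : (<< m >> : M) = \prod_(x <- mword m) pvar P x.
Proof. by rewrite -vprod_word; apply: vprodE. Qed.

Definition fmulP (p : P) (v : V) : V := fmul (p : M) v.

Lemma fmulP_is_linear p : linear (fmulP p).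
Proof.
move=> c u v; rewrite /fmulP /fmul /linext scaler_sumr -big_split.
apply: eq_bigr => m _ /=.
by rewrite -!/(linext _ _) linearP scalerDr !scalerA [c * _]mulrC.
Qed.
HB.instance Definition _ p :=
  GRing.isLinear.Build K V V _ (fmulP p) (fmulP_is_linear p).

Lemma fmul_var i k (v : V) : fmul (<< ucm (i, k) >> : M) v = fmulP (var i k) v.
Proof. by []. Qed.

Definition fmulPr v : P -> V := fmulP^~ v.
Lemma fmulPr_is_linear v : linear (fmulPr v).
Proof.
exact: (linext_is_linear (fun m : mon =>
  linext (fun b : mon * dual G => bvec K (mmul m b.1) b.2) v)).
Qed.
HB.instance Definition _ v :=
  GRing.isLinear.Build K P V _ (fmulPr v) (fmulPr_is_linear v).

Lemma fmulP_prod t (m : mon) b :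
  fmulP (\prod_(x <- t) pvar P x) (bvec K m b) = bvec K (mmul (mprod t) m) b.
Proof.
have <- : vprod K t = \prod_(x <- t) pvar P x by exact: vprodE.
by rewrite /fmulP /fmul /vprod linextU linextU.
Qed.

Lemma dvar_prod x t b : dvar x (bvec K (mprod t) b : V) =
  emb b (pder (fun y => (y == x)%:R : P) (\prod_(x <- t) pvar P x)).
Proof.
have <- : vprod K t = \prod_(x <- t) pvar P x by exact: vprodE.
pose u : P := (<< divcm (mprod t) (ucm x) >> : M).
have -> : pder (fun y => (y == x)%:R : P) (vprod K t) = (mprod t x)%:R *: u.
  exact: pdU.
by rewrite /dvar linextU embZ /u embU.
Qed.

Definition toP (p : fock K n) : P := p.
Definition ofP (p : P) : fock K n := p.

Lemma ofPK : cancel ofP toP. Proof. by []. Qed.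

Lemma fmul_toP p (v : V) : fmul p v = fmulP (toP p) v.
Proof. by []. Qed.

Lemma subspace_symS (S : {set 'I_n}) : subspace (@symS K n S).
Proof.
split=> [m|c u v Su Sv m]; first by rewrite msupp0 in_fset0.
move=> /(fsubsetP (msuppD_le _ _)); rewrite in_fsetU => /orP [].
  by move=> /(fsubsetP (msuppZ_le _ _)); apply: Su.
exact: Sv.
Qed.

Lemma symS_toP S p : symS S p <-> symw S (toP p).
Proof.
split=> [Sp|].
  apply: (@subspace_malg K mon (fun q => symw S (toP q))); first exact: subspace_symw.
  move=> m mp; rewrite /toP fock_word; apply: sub_lspan; exists (mword m) => //.
  by apply/allP => x; rewrite mem_mword; apply: (Sp m mp).
move=> Sp; apply: (Sp (fun q => symS S (ofP q))); first exact: subspace_symS.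
move=> _ [t tS ->] m; have <- : vprod K t = \prod_(x <- t) pvar P x by exact: vprodE.
rewrite /ofP msuppU oner_eq0 in_fset1 => /eqP -> x; rewrite mprodE => xt.
by apply: (allP tS); rewrite -has_pred1 has_count lt0n.
Qed.

End Embedding.

HB.instance Definition _ (K : fieldType) n (G : 'M[int]_n) x :=
  GRing.isLinear.Build K (VLdual K G) (VLdual K G) _ (@dvar K n G x) (linext_is_linear _).

Local Opaque fockR emb fmulP toP ofP.

Section Operators.
Variables (K : fieldType) (n : nat) (G : 'M[int]_n).
Local Notation P := (fockR K ('I_n * nat)%type).
Local Notation V := (VLdual K G).
Local Notation var i k := (pvar P (i, k%N)).
Implicit Types (b : dual G) (p q : P).

Lemma mprod_cat (I : choiceType) (s t : seq I) :
  mmul (mprod s) (mprod t) = mprod (s ++ t).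
Proof. by apply/eqP/cmP => y; rewrite cmM !mprodE count_cat. Qed.

Lemma fmulP_emb p q b : fmulP p (emb b q) = emb b (p * q).
Proof.
pose f := [the {linear P -> V} of fmulPr (emb b q)].
pose f' := [the {linear P -> V} of emb b \o mulp q].
suff : f =1 f' by move=> /(_ p); rewrite /= /mulp mulrC.
apply: plinearP => s; rewrite /f /f' /= /mulp mulrC.
pose g := [the {linear P -> V} of fmulP (\prod_(x <- s) pvar P x) \o emb b].
pose g' := [the {linear P -> V} of emb b \o mulp (\prod_(x <- s) pvar P x)].
suff : g =1 g' by apply.
apply: plinearP => t; rewrite /g /g' /= /mulp emb_prod fmulP_prod mprod_cat.
by rewrite -big_cat emb_prod.
Qed.

Lemma dvar_emb x b p : dvar x (emb b p) = emb b (pder (fun y => (y == x)%:R : P) p).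
Proof.
pose f := [the {linear P -> V} of @dvar K n G x \o emb b].
pose f' := [the {linear P -> V} of emb b \o pder (fun y => (y == x)%:R : P)].
suff : f =1 f' by apply.
by apply: plinearP => t; rewrite /f /f' /= emb_prod dvar_prod.
Qed.

End Operators.

(** * Vertex operators on p (x) e^b *)

Section VertexOperators.
Variables (K : fieldType) (charK0 : [pchar K] =i pred0) (n : nat) (G : 'M[int]_n).
Hypothesis G_sym : G^T = G.
Variable eps : dual G -> dual G -> K.
Local Notation P := (fockR K ('I_n * nat)%type).
Local Notation V := (VLdual K G).
Local Notation var i k := (pvar P (i, k%N)).
Implicit Types (b : dual G) (p q r : P) (v : V).

Lemma heis_is_linear h j : linear (@heis K n G h j).
Proof.
case: j => [[|k]|k] c u v; first exact: linext_is_linear.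
  rewrite /heis scaler_sumr -big_split; apply: eq_bigr => i _ /=.
  by rewrite linearP scalerDr !scalerA [c * _]mulrC.
rewrite /heis scaler_sumr -big_split; apply: eq_bigr => i _ /=.
by rewrite !fmul_var linearP scalerDr !scalerA [c * _]mulrC.
Qed.
HB.instance Definition _ h j :=
  GRing.isLinear.Build K V V _ (@heis K n G h j) (heis_is_linear h j).

Lemma VLdual_span (U : set V) : subspace U ->
  (forall b p, U (emb b p)) -> forall v, U v.
Proof.
move=> sU UP v; apply: subspace_malg => // -[m b] _.
by have := UP b (\prod_(x <- mword m) pvar P x); rewrite emb_prod mwordK.
Qed.

Lemma heis0_emb h b p : heis h 0 (emb b p) = bform G h (cvec K b) *: emb b p.
Proof.
pose f := [the {linear P -> V} of [the {linear V -> V} of @heis K n G h 0] \o emb b].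
pose f' := [the {linear P -> V} of bform G h (cvec K b) \*: emb b].
suff : f =1 f' by apply.
by apply: plinearP => t; rewrite /f /f' /= emb_prod linextU.
Qed.

Lemma heisP_emb h k b p : heis h k.+1 (emb b p) =
  emb b (dann P (fun i => bform G h (cbasis K i)) k p).
Proof.
rewrite dannE [RHS]linear_sum; apply: eq_bigr => i _.
by rewrite dvar_emb linearZ.
Qed.

Lemma heisN_emb h k b p : heis h (Negz k) (emb b p) =
  emb b ((\sum_i h 0 i *: var i k) * p).
Proof.
rewrite mulr_suml [RHS]linear_sum; apply: eq_bigr => i _.
by rewrite fmul_var fmulP_emb -scalerAl linearZ.
Qed.

Lemma expannih_emb b c k p : expannih c k (emb b p) =
  emb b (aexp (fun i => bform G (cvec K c) (cbasis K i)) k p).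
Proof.
by apply/esym/fexp_morph => j w; rewrite linearZ /= -heisP_emb.
Qed.

(** The defining exponential of creation operators and exp(x (T + al(-1))) 1 obey the same Newton
    recursion. *)
Lemma expcreate_emb b (al : 'rV[int]_n) k p : expcreate (latt G al) k (emb b p) =
  emb b (creat (\sum_i (al 0 i)%:~R *: var i 0) k 1 * p).
Proof.
have cal i : cvec K (latt G al) 0 i = (al 0 i)%:~R by rewrite !mxE ratr_int.
pose cr j : P := \sum_i (al 0 i)%:~R *: var i j.
pose a j := fun q : P => (j%:R)^-1 *: mulp (cr j.-1) q.
have -> : expcreate (latt G al) k (emb b p) = emb b (fexp a k p).
  apply/esym/fexp_morph => j w; rewrite linearZ; congr (_ *: _).
  rewrite -[RHS]/(heis (cvec K (latt G al)) (Negz j) (emb b w)) heisN_emb.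
  have -> // : \sum_i cvec K (latt G al) 0 i *: var i j = cr j.
  by apply: eq_bigr => i _; rewrite cal.
congr (emb b _); transitivity (fexp a k 1 * p).
  have E : mulp p (fexp a k 1) = fexp a k (mulp p 1).
    apply: (fexp_morph (e := [the {linear P -> P} of mulp p])) => j w /=.
    by rewrite linearZ /= mulpC.
  by move: E; rewrite /mulp mulr1 => <-; rewrite mulrC.
congr (_ * p); move: k.
apply: (eq_newton (o := fun j q => cr j * q) charK0) => [|k|k].
- by rewrite fexp0 creat0.
- rewrite (fexp_newton charK0 (fun j => (j%:R)^-1)
    (o := fun j => [the {linear P -> P} of mulp (cr j.-1)])).
    apply: eq_bigr => j _; rewrite /= scalerA mulfV ?scale1r //.
    by rewrite ((pcharf0P K).1 charK0).
  by move=> i j w; apply: mulpC.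
- exact: creat_newton.
Qed.

Lemma emodeU al m c :
  emode eps al m (bvec K c.1 c.2 : V) = \sum_(p \in [set p : (nat * nat)%type |
        p.1%:R - p.2%:R + bform G (dual_val al) (dual_val c.2)
          = - m%:~R - 1 :> rat])
      expcreate al p.1 (expannih al p.2 (eps al c.2 *: bvec K c.1 (al + c.2))).
Proof. by case: c => c1 c2; apply: linextU. Qed.

Lemma emode_is_linear al m : linear (emode eps al m : V -> V).
Proof. exact: linext_is_linear. Qed.
HB.instance Definition _ al m :=
  GRing.isLinear.Build K V V _ (emode eps al m) (emode_is_linear al m).

Local Opaque heis expcreate expannih emode.

Lemma nop0 s al m : nop eps s al m (0 : V) = 0.
Proof.
elim: s m => [|[i k] s IH] m; first exact: (linear0 (emode eps al m)).
rewrite [LHS]/= -[RHS]addr0; apply: (congr2 +%R); apply: fsbig1 => j _.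
  by rewrite IH (linear0 (heis _ _)) scaler0.
by rewrite (linear0 (heis _ _)) IH scaler0.
Qed.

Lemma Ymode0l m v : Ymode eps 0 m v = 0 :> V.
Proof. exact: (linear0 (linext (fun c : {cmonom ('I_n * nat)%type} * dual G =>
  nop eps (word c.1) c.2 m v))). Qed.

Lemma YmodePl m v c (u w : V) :
  Ymode eps (c *: u + w) m v = c *: Ymode eps u m v + Ymode eps w m v.
Proof. exact: linext_is_linear. Qed.

Section ModesOnCharge.
Variables (al : 'rV[int]_n) (b : dual G) (z : int).
Hypothesis zE : bform G (dual_val (latt G al)) (dual_val b) = z%:~R.

Let gram i i' : K := bform G (cbasis K i) (cbasis K i').
Let ac i : K := bform G (cvec K (latt G al)) (cbasis K i).
Let zc i : K := bform G (cbasis K i) (cvec K b).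
Let e := eps (latt G al) b.
Let F0 N : P -> P -> int -> P := fld0 ac al z e N.
Let F N s : P -> P -> int -> P := fld gram ac zc al z e N s.
Let Fhat N : {linear P -> (P -> P -> int -> P)} := fldhat P gram ac zc al z e N.

(** From N on no annihilation term sees p, so the sums over the annihilation index may stop at N. *)
Definition cutoff N p := (forall i j, (N <= j)%N -> ann gram zc i j p = 0) /\
  (forall k, (N <= k)%N -> aexp ac k p = 0).

Lemma cutoff_exists p : exists N0, forall N, (N0 <= N)%N -> cutoff N p.
Proof.
have [w wp] := wtle_exists p; exists (absz w).+1 => N wN; split=> [i [|j] jN|k kN].
- by lia.
- by apply: (wtle_neg (w := w - j.+1%:Z)); [lia | apply: wtle_dann].
- by apply: (wtle_neg (w := w - k%:Z)); [lia | apply: wtle_aexp].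
Qed.

Lemma cutoff_ann N i j p : cutoff N p -> cutoff N (ann gram zc i j p).
Proof.
move=> [p1 p2]; split=> [i' j' j'N|k kN].
  by rewrite annC p1 // linear0.
by rewrite -aexp_ann p2 // linear0.
Qed.

Lemma fld0_cutoff N N' p q m : (N <= N')%N -> (forall k, (N <= k)%N -> aexp ac k p = 0) ->
  F0 N p q m = F0 N' p q m.
Proof.
move=> NN' p0; rewrite /F0 /fld0 [RHS](big_cat_nat (n := N)) //=.
rewrite [X in _ = _ + X]big_nat [X in _ = _ + X]big1 ?addr0 // => k /andP [Nk _].
by rewrite p0 // scaler0 mulr0.
Qed.

Lemma emode_emb N m p : cutoff N p ->
  emode eps (latt G al) m (emb b p) = emb (latt G al + b) (F0 N p 1 m).
Proof.
(* The words composing p may need a larger cutoff than p itself, so the span argument treats all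
   large N and [fld0_cutoff] returns to the given one. *)
move=> [_ pN]; suff [N0 N0E] : exists N0, forall N, (N0 <= N)%N ->
    emode eps (latt G al) m (emb b p) = emb (latt G al + b) (F0 N p 1 m).
  apply: (etrans (N0E _ (leq_maxl N0 N))); congr (emb _ _).
  exact: (esym (fld0_cutoff _ _ (leq_maxr N0 N) pN)).
move: p {pN}; apply: (@pspan _ _ P [set p | exists N0, forall N, (N0 <= N)%N ->
    emode eps (latt G al) m (emb b p) = emb (latt G al + b) (F0 N p 1 m)]).
  split=> [|c u v [N1 E1] [N2 E2]].
    exists 0%N => N' _; have -> : F0 N' 0 1 m = 0 by exact: fld0_v0.
    by rewrite !(linear0 (emb _)) linear0.
  exists (maxn N1 N2) => N'; rewrite geq_max => /andP [N1N' N2N'].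
  have -> : F0 N' (c *: u + v) 1 m = c *: F0 N' u 1 m + F0 N' v 1 m.
    exact: fld0P.
  rewrite (emb_is_linear b c u v) emode_is_linear (emb_is_linear _ c).
  by apply: (congr2 (fun x y => c *: x + y)); [apply: E1 | apply: E2].
move=> t; have [N0 cut] := cutoff_exists (\prod_(x <- t) pvar P x).
exists N0 => N' /cut [_ cutE].
rewrite emb_prod (emodeU _ _ (_, _)) /=.
rewrite (fsum_modes m (N := N') (F := fun j k => expcreate (latt G al) j
   (expannih (latt G al) k (e *: bvec K (mprod t) (latt G al + b)))) zE).
  rewrite /F0 /fld0 linear_sum; apply: eq_bigr => k _.
  have E : expannih (latt G al) k (e *: bvec K (mprod t) (latt G al + b)) =
      emb (latt G al + b) (e *: aexp ac k (\prod_(x <- t) pvar P x)) :> V.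
    by rewrite -emb_prod -linearZ expannih_emb linearZ.
  have E2 j := etrans (congr1 (expcreate (latt G al) j) E) (expcreate_emb _ _ _ _).
  case: (_ - 1) => j; first exact: E2.
  by rewrite [LHS]/= [creatz _ _ _]/= mul0r (linear0 (emb _)).
move=> j k kN; rewrite -emb_prod -linearZ expannih_emb linearZ /= cutE //.
by rewrite scaler0 -(linear0 (emb (latt G al + b))) expcreate_emb mulr0.
Qed.

Lemma heis_ann i j p : heis (cbasis K i) j%:Z (emb b p) = emb b (ann gram zc i j p).
Proof.
case: j => [|j]; last exact: heisP_emb.
by rewrite heis0_emb -linearZ.
Qed.

Lemma heis_create i j (c : dual G) p : heis (cbasis K i) (Negz j) (emb c p) = emb c (var i j * p).
Proof.
rewrite heisN_emb.
have -> // : \sum_l cbasis K i 0 l *: var l j = var i j.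
rewrite (bigD1 i) //= mxE !eqxx scale1r big1 ?addr0 // => l /negPf li.
by rewrite mxE li andbF scale0r.
Qed.

Lemma nop_emb N s m p : cutoff N p ->
  nop eps s (latt G al) m (emb b p) = emb (latt G al + b) (F N s p 1 m).
Proof.
elim: s m p => [|[i k] s IH] m p cut; first exact: emode_emb.
(* Chosen so that the modes m + j - k with j >= B lie beyond [fldbound]. *)
pose B := absz (fldbound z N s - m + k%:Z).
have fB : fldbound z N s <= m + B%:Z - k%:Z by rewrite /B; lia.
rewrite [LHS]/=.
apply: (etrans (congr2 +%R (fsum_nat (B := B) _) (fsum_nat (B := N) _))) => [j jB|j jN|].
- rewrite (IH _ _ cut) (_ : F N s p 1 _ = 0); last by apply: fld_trunc; lia.
  by rewrite (linear0 (emb _)) (linear0 (heis _ _)) scaler0.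
- by rewrite heis_ann (cut.1 i j jN) (linear0 (emb b)) nop0 scaler0.
have -> : F N ((i, k) :: s) p 1 m = F N s p (var i k * 1) m +
   rfld gram zc N (i, k) (F N s) p 1 m by exact: fld_cons.
rewrite (linearD (emb _)); congr (_ + _).
  have -> : F N s p (var i k * 1) m = \sum_(0 <= j < B)
    'C(j, k)%:R *: (var i j * F N s p 1 (m + j%:Z - k%:Z)) by exact: fld_varM.
  rewrite (linear_sum (emb _)); apply: eq_bigr => j _.
  by rewrite (IH _ _ cut) heis_create -linearZ.
rewrite /rfld (linear_sum (emb _)); apply: eq_bigr => j _.
by rewrite heis_ann (IH _ _ (cutoff_ann i j cut)) -linearZ.
Qed.

(** The bridge to polynomial operators. By linearity in r it reduces to [nop_emb]; the order of the
    letters in [word] is immaterial by [fld_perm]. *)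
Lemma Ymode_emb N m r p : cutoff N p ->
  Ymode eps (emb (latt G al) r) m (emb b p) = emb (latt G al + b) (Fhat N r p 1 m).
Proof.
move=> cut; move: r; apply: (@pspan _ _ P [set r |
    Ymode eps (emb (latt G al) r) m (emb b p) = emb (latt G al + b) (Fhat N r p 1 m)]).
  split=> [|c u v Eu Ev].
    rewrite /= (linear0 (emb (latt G al))) Ymode0l (linear0 (Fhat N)).
    by apply/esym; apply: (linear0 (emb (latt G al + b))).
  rewrite /=.
  have -> : Fhat N (c *: u + v) p 1 m = c *: Fhat N u p 1 m + Fhat N v p 1 m.
    by rewrite linearP.
  rewrite (emb_is_linear (latt G al) c u v) (emb_is_linear _ c) YmodePl.
  exact: (congr2 (fun x y => c *: x + y) Eu Ev).
move=> t; rewrite /= emb_prod /Ymode linextU.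
have -> : Fhat N (\prod_(x <- t) pvar P x) = F N t by exact: fldhat_prod.
have <- : F N (mword (mprod t)) = F N t by apply: fld_perm; apply: perm_mword.
exact: nop_emb.
Qed.

End ModesOnCharge.

(** The dual lattice is defined with its vector on the left; symmetry of G exchanges the sides. *)
Lemma latt_pairing (al : 'rV[int]_n) b :
  exists z : int, bform G (dual_val (latt G al)) (dual_val b) = z%:~R.
Proof.
case: b => x bx; have /asboolP /(_ al) /intrP [z zE] := bx; exists z; rewrite -zE.
have tr (y : 'M[rat]_1) : y 0 0 = y^T 0 0 by rewrite mxE.
have Gt : (map_mx intr G)^T = map_mx intr G :> 'M[rat]_n by rewrite map_trmx G_sym.
by rewrite /bform [LHS]tr !trmx_mul trmxK Gt mulmxA.
Qed.

Lemma heis_bound v : exists B, forall j i, (B <= j)%N -> heis (cbasis K i) j%:Z v = 0.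
Proof.
move: v; apply: VLdual_span => [|b p].
  split=> [|c u v [B1 E1] [B2 E2]].
    by exists 0%N => j i _; exact: (linear0 (heis (cbasis K i) j)).
  exists (maxn B1 B2) => j i; rewrite geq_max => /andP [j1 j2].
  rewrite (heis_is_linear _ _ c u v).
  by apply: (etrans (congr2 (fun x y => c *: x + y) (E1 j i j1) (E2 j i j2)));
    rewrite scaler0 addr0.
have [z zE] := latt_pairing 0 b; have [N /(_ N (leqnn N)) [pN _]] := cutoff_exists 0 b p.
by exists N => j i jN; rewrite heis_ann // pN // (linear0 (emb b)).
Qed.

(** The two claims need each other: truncation for [s] is reduced to vectors p (x) e^b by linearity,
    and linearity for a longer word needs truncation for [s] to make the sums finite. *)
Lemma nop_linear_trunc s (al : 'rV[int]_n) :
  (forall m, linear (nop eps s (latt G al) m : V -> V)) /\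
  (forall v, exists M : int, forall m, M <= m -> nop eps s (latt G al) m v = 0).
Proof.
have trunc t : (forall m, linear (nop eps t (latt G al) m : V -> V)) ->
    forall v, exists M : int, forall m, M <= m -> nop eps t (latt G al) m v = 0.
  move=> lin; apply: VLdual_span => [|b p].
    split=> [|c u v [M1 E1] [M2 E2]]; first by exists 0 => m _; exact: nop0.
    exists (Order.max M1 M2) => m; rewrite ge_max => /andP [m1 m2].
    rewrite (lin m c u v).
    by apply: (etrans (congr2 (fun x y => c *: x + y) (E1 m m1) (E2 m m2)));
      rewrite scaler0 addr0.
  have [z zE] := latt_pairing al b.
  have [N /(_ N (leqnn N)) cut] := cutoff_exists al b p.
  exists (fldbound z N t) => m tm; rewrite (nop_emb zE t m cut).
  by rewrite fld_trunc // (linear0 (emb _)).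
elim: s => [|[i k] s [linS truncS]].
  have lin m : linear (nop eps [::] (latt G al) m : V -> V) by exact: emode_is_linear.
  by split=> //; apply: trunc.
suff lin m : linear (nop eps ((i, k) :: s) (latt G al) m : V -> V).
  by split=> //; apply: trunc.
move=> c u v.
have [[B1 hu] [B2 hv]] := (heis_bound u, heis_bound v).
have [[M1 nu] [M2 nv]] := (truncS u, truncS v).
pose B := (maxn (maxn B1 B2) (absz (Order.max M1 M2 - m + k%:Z))).
have nE w : (forall j, (B <= j)%N -> heis (cbasis K i) j%:Z w = 0) ->
   (forall m', Order.max M1 M2 <= m' -> nop eps s (latt G al) m' w = 0) ->
   nop eps ((i, k) :: s) (latt G al) m w =
   \sum_(0 <= j < B) 'C(j, k)%:R *: heis (cbasis K i) (Negz j)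
       (nop eps s (latt G al) (m + j%:Z - k%:Z) w) +
   \sum_(0 <= j < B) ((-1) ^+ k * 'C(j + k, k)%:R) *:
       nop eps s (latt G al) (m - j%:Z - k.+1%:Z) (heis (cbasis K i) j%:Z w).
  move=> hw nw; apply: (congr2 +%R); apply: fsum_nat => j jB.
    rewrite -[LHS]/('C(j, k)%:R *: heis (cbasis K i) (Negz j)
      (nop eps s (latt G al) (m + j%:Z - k%:Z) w)).
    rewrite nw; last by move: jB; rewrite /B geq_max => /andP [_]; lia.
    by rewrite (linear0 (heis _ _)) scaler0.
  rewrite -[LHS]/(((-1) ^+ k * 'C(j + k, k)%:R) *:
    nop eps s (latt G al) (m - j%:Z - k.+1%:Z) (heis (cbasis K i) j%:Z w)).
  by rewrite hw // nop0 scaler0.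
have hu' j : (B <= j)%N -> heis (cbasis K i) j%:Z u = 0.
  by rewrite /B !geq_max => /andP [/andP [j1 _] _]; apply: hu.
have hv' j : (B <= j)%N -> heis (cbasis K i) j%:Z v = 0.
  by rewrite /B !geq_max => /andP [/andP [_ j2] _]; apply: hv.
have nu' m' : Order.max M1 M2 <= m' -> nop eps s (latt G al) m' u = 0.
  by rewrite ge_max => /andP [m1 _]; apply: nu.
have nv' m' : Order.max M1 M2 <= m' -> nop eps s (latt G al) m' v = 0.
  by rewrite ge_max => /andP [_ m2]; apply: nv.
have zc0 : c *: (0 : V) + 0 = 0 by rewrite scaler0 addr0.
rewrite (nE u hu' nu') (nE v hv' nv') nE; first last.
- by move=> m' mm'; apply: (etrans (linS m' c u v));
    apply: (etrans (congr2 (fun x y => c *: x + y) (nu' m' mm') (nv' m' mm'))).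
- by move=> j jB; apply: (etrans (heis_is_linear _ _ c u v));
    apply: (etrans (congr2 (fun x y => c *: x + y) (hu' j jB) (hv' j jB))).
apply: (@linear_sum_add K V V B (fun j w => 'C(j, k)%:R *: heis (cbasis K i) (Negz j)
    (nop eps s (latt G al) (m + j%:Z - k%:Z) w))
  (fun j w => ((-1) ^+ k * 'C(j + k, k)%:R) *:
    nop eps s (latt G al) (m - j%:Z - k.+1%:Z) (heis (cbasis K i) j%:Z w))) => j.
  exact: linear_scale_comp (heis_is_linear _ _) (linS _).
exact: linear_scale_comp (linS _) (heis_is_linear _ _).
Qed.

Lemma YmodePr (al : 'rV[int]_n) r m c (u w : V) :
  Ymode eps (emb (latt G al) r) m (c *: u + w) =
  c *: Ymode eps (emb (latt G al) r) m u + Ymode eps (emb (latt G al) r) m w.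
Proof.
move: r; apply: (@pspan _ _ P [set r | Ymode eps (emb (latt G al) r) m (c *: u + w) =
  c *: Ymode eps (emb (latt G al) r) m u + Ymode eps (emb (latt G al) r) m w]).
  split=> [|d r r' Er Er'] /=.
    by rewrite (linear0 (emb (latt G al))) !Ymode0l scaler0 addr0.
  rewrite (emb_is_linear (latt G al) d r r') !YmodePl.
  apply: (etrans (congr2 (fun x y => d *: x + y) Er Er')).
  exact: scale_interchange.
move=> t; rewrite /= emb_prod /Ymode !linextU.
exact: (nop_linear_trunc _ al).1.
Qed.

End VertexOperators.

Local Opaque Ymode.

(** * The explicit model of the modules *)

Section Modules.
Variables (K : fieldType) (charK0 : [pchar K] =i pred0) (n : nat) (G : 'M[int]_n).
Hypothesis G_sym : G^T = G.
Variable eps : dual G -> dual G -> K.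
Hypothesis eps_neq0 : forall a c, eps (latt G a) c != 0.
Hypothesis eps0 : forall c, eps 0 c = 1.
Local Notation P := (fockR K ('I_n * nat)%type).
Local Notation V := (VLdual K G).
Local Notation var i k := (pvar P (i, k%N)).
Implicit Types (b lam : dual G) (p q r : P) (v : V) (R S : {set 'I_n}).
Implicit Types (D E : set 'rV[int]_n) (d : 'rV[int]_n).

Lemma lattD d d' : latt G (d + d') = latt G d + latt G d'.
Proof. by apply: val_inj; rewrite /= map_mxD. Qed.

Lemma latt0 : latt G 0 = 0.
Proof. by apply: val_inj; rewrite /= map_mx0. Qed.

Lemma latt_inj : injective (latt G).
Proof.
move=> d d' /(congr1 (fun b => dual_val b)) /= /matrixP dd'; apply/matrixP => i j.
by have := dd' i j; rewrite !mxE => /intr_inj.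
Qed.

(** With S empty and D = L(R) this will be W(R; lam); with D = [supp2 R S] it will be W(R, S; lam);
    with D = L(R) and lam = 0, S(h(S)_-) (x) W(R). *)
Definition hmod R S D lam : set V :=
  lspan [set v | exists d q, [/\ D d, hfil R S d q & v = emb (latt G d + lam) q]].

Lemma subspace_hmod R S D lam : subspace (hmod R S D lam).
Proof. exact: subspace_lspan. Qed.

Lemma hmodI R S D lam d q : D d -> hfil R S d q -> hmod R S D lam (emb (latt G d + lam) q).
Proof. by move=> Dd Hq; apply: sub_lspan; exists d, q. Qed.

(** The lattice L(R) + L(S); nonnegativity on R is left to [hcap]. *)
Definition supp2 R S : set 'rV[int]_n :=
  [set d | forall i, i \notin R -> i \notin S -> d 0 i = 0].

Lemma hmod_Ymode R S D1 D2 D3 lam u v m : D1 `<=` supp2 R S ->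
    (forall a d, D1 a -> D2 d -> D3 (d + a)) ->
  hmod R S D1 0 u -> hmod R S D2 lam v -> hmod R S D3 lam (Ymode eps u m v).
Proof.
move=> D1s D123 + Hv; move: u.
apply: (@lspan_min _ _ _ [set u | hmod R S D3 lam (Ymode eps u m v)]).
  split=> [|c u w Hu Hw] /=.
    by rewrite Ymode0l; case: (subspace_hmod R S D3 lam).
  by rewrite YmodePl; exact: (subspaceP _ (subspace_hmod _ _ _ _) Hu Hw).
move=> _ [a [r [Da Hr ->]]] /=; rewrite addr0; move: v Hv.
apply: (@lspan_min _ _ _ [set v | hmod R S D3 lam (Ymode eps (emb (latt G a) r) m v)]).
  split=> [|c v w Hv Hw] /=.
    have := YmodePr charK0 G_sym eps a r m (-1) 0 0.
    rewrite scaler0 addr0 scaleN1r addNr => ->.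
    by case: (subspace_hmod R S D3 lam).
  rewrite (YmodePr charK0) //.
  exact: (subspaceP _ (subspace_hmod _ _ _ _) Hv Hw).
move=> _ [d [p [Dd Hp ->]]] /=.
have [z zE] := latt_pairing G_sym a (latt G d + lam).
have [N /(_ N (leqnn N)) cut] := cutoff_exists a (latt G d + lam) p.
rewrite (@Ymode_emb _ charK0 _ _ eps _ _ _ zE _ _ _ _ cut) addrA -lattD [a + d]addrC.
by apply: hmodI; [apply: D123 | apply: hfil_fldhat => // i iR iS; apply: D1s].
Qed.

Lemma bvec_var i : bvec K (ucm (i, 0%N)) 0 = emb (latt G 0) (var i 0) :> V.
Proof.
have := emb_prod K (latt G 0) [:: (i, 0%N)]; rewrite big_seq1 latt0 => ->.
by rewrite (_ : mprod _ = ucm (i, 0%N)) //; apply/eqP/cmP => y; rewrite /= cmM cm1 addn0.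
Qed.

Lemma lspan_emb c (A : set P) (U : set V) : subspace U ->
  (forall x, A x -> U (emb c x)) -> forall x, lspan A x -> U (emb c x).
Proof. exact: (lspan_image (f := [the {linear P -> V} of emb c])). Qed.

(** * Reaching every H_d by modes of the generators *)

Section Generation.
Variables (R S : {set 'I_n}) (U : set V).
Hypothesis sU : subspace U.
Hypothesis U_R : forall i v m, i \in R -> U v -> U (Ymode eps (ee K (latt G (basis i))) m v).
Hypothesis U_Sp : forall i v m, i \in S -> U v -> U (Ymode eps (ee K (latt G (basis i))) m v).
Hypothesis U_Sm : forall i v m, i \in S -> U v -> U (Ymode eps (ee K (latt G (- basis i))) m v).
Hypothesis U_S0 : forall i v m, i \in S -> U v -> U (Ymode eps (bvec K (ucm (i, 0%N)) 0) m v).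

(** The mode -<al, b> - 1 of e^al sends e^b to a nonzero multiple of e^(al + b). *)
Lemma gen_charge (al : 'rV[int]_n) b :
  (forall v m, U v -> U (Ymode eps (ee K (latt G al)) m v)) ->
  U (emb b 1) -> U (emb (latt G al + b) 1).
Proof.
move=> Ual Ub; have [z zE] := latt_pairing G_sym al b.
have [N0 cut0] := cutoff_exists al b (1 : P).
(* The cutoff N0 + 1 guarantees that the sum contains the annihilation index 0. *)
have cut := cut0 _ (leqnSn N0); have := Ual _ (- z - 1) Ub.
rewrite -emb1 (@Ymode_emb _ charK0 _ _ eps _ _ _ zE _ _ _ _ cut) fldhat1.
set f := fld0 _ _ _ _ _ _ _ _; suff -> : f = eps (latt G al) b *: 1.
  by rewrite embZ => /(subspace_unscale sU (eps_neq0 al b)).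
rewrite /f /fld0 big_ltn // big_nat big1 ?addr0 => [|k k0]; last first.
  by rewrite aexp_1 ?scaler0 ?mulr0 //; lia.
by rewrite aexp0 (_ : _ - 1 = 0%N%:Z) ?[creatz _ _ _]creat0 ?mul1r //; lia.
Qed.

Lemma gen_create i k b p : i \in S -> U (emb b p) -> U (emb b (var i k * p)).
Proof.
move=> iS Ub; have zE : bform G (dual_val (latt G 0)) (dual_val b) = 0%:~R.
  by rewrite latt0 /bform !mul0mx mxE.
have [N0 cut0] := cutoff_exists 0 b p.
have cut := cut0 _ (leqnSn N0); have := U_S0 (Negz k) iS Ub.
have varE : var i 0 = \prod_(x <- [:: (i, 0%N)]) pvar P x by rewrite big_seq1.
rewrite bvec_var varE.
rewrite (@Ymode_emb _ charK0 _ _ eps _ _ _ zE _ _ _ _ cut) fldhat_prod latt0 add0r eps0.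
set ac := (X in fld _ X); have -> : ac = fun=> 0.
  apply/funext => l; rewrite /ac /bform /cvec.
  have -> : dual_val (0 : dual G) = 0 by [].
  have -> : map_mx ratr (0 : 'rV[rat]_n) = 0 :> 'rV[K]_n.
    by apply/matrixP => x y; rewrite !mxE; apply: (ratr_int K 0).
  by rewrite !mul0mx mxE.
by rewrite fld_charge0.
Qed.

(** A subspace H stable under annihilation replaces a single q, because the induction on weight is
    applied to the polynomials [aexp ac k q]. *)
Lemma gen_hser i b (H : set P) : subspace H -> (forall c k q, H q -> H (aexp c k q)) ->
    (forall v m, U v -> U (Ymode eps (ee K (latt G (basis i))) m v)) ->
    (forall q, H q -> U (emb b q)) ->
  forall a q, H q -> U (emb (latt G (basis i) + b) (hser P i a * q)).
Proof.
move=> sH Ha Ui Ub.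
suff IH (w : nat) : forall a q, H q -> wtle (w%:Z - 1) q ->
    U (emb (latt G (basis i) + b) (hser P i a * q)).
  move=> a q Hq; have [w wq] := wtle_exists q.
  apply: (IH (absz w).+1) => //; move: wq; apply: lspan_min.
    exact: subspace_wtle.
  by move=> _ [t tw ->]; apply: sub_lspan; exists t => //; apply: le_trans tw _; lia.
elim/ltn_ind: w => w IH a q Hq wq.
have [z zE] := latt_pairing G_sym (basis i) b.
have [N0 cut0] := cutoff_exists (basis i) b q.
have cut := cut0 _ (leqnSn N0); have := Ui _ (- z - 1 - a%:Z) (Ub q Hq).
rewrite -emb1 (@Ymode_emb _ charK0 _ _ eps _ _ _ zE _ _ _ _ cut) fldhat1.
set e := eps _ b; set ac := (X in fld0 X).
have E := fld0_hser charK0 ac i z e N0 a q.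
move=> /(eq_ind _ (fun x => U (emb (latt G (basis i) + b) x))) => /(_ _ E).
rewrite embD embZ => Us.
suff Ur : U (emb (latt G (basis i) + b)
    (\sum_(1 <= k < N0.+1) hser P i (a + k) * (e *: aexp ac k q))).
  have := subspaceB sU Us Ur; rewrite addrK.
  exact: (subspace_unscale sU (eps_neq0 (basis i) b)).
rewrite emb_sum big_nat; apply: (subspace_sum _ sU) => k k1.
rewrite -scalerAr embZ; apply: (subspaceZ _ sU).
have aw : wtle (w%:Z - 1 - k%:Z) (aexp ac k q) by apply: wtle_aexp.
have [wk|kw] := leqP w k.
  have a0 : aexp ac k q = 0 by apply: (wtle_neg _ aw); lia.
  by rewrite a0 mulr0 (linear0 (emb _)); case: sU.
apply: (IH (w - k)%N); [by lia | exact: Ha |].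
by move: aw; rewrite (_ : w%:Z - 1 - k%:Z = (w - k)%N%:Z - 1) //; lia.
Qed.

(** Charges in L(S) are reached by single steps sigma or -sigma, by induction on sum_i |d_i|. *)
Lemma gen_lattice lam (d : 'rV[int]_n) : U (ee K lam) ->
  (forall i, i \notin S -> d 0 i = 0) -> U (emb (latt G d + lam) 1).
Proof.
move=> Ulam; have [k] := ubnP (\sum_i absz (d 0 i)%R)%N.
elim: k d => [d k0|k IH d]; first by exfalso; move: k0; rewrite ltn0.
rewrite ltnS => dk dS.
have [i d_i|d0] := pickP (fun i => d 0 i != 0); last first.
  have -> : d = 0 by apply/rowP => i; rewrite mxE; apply/eqP/negbFE/d0.
  by rewrite latt0 add0r emb1.
have iS : i \in S by apply: contraNT d_i => /dS ->.
pose s : 'rV[int]_n := if 0 < d 0 i then basis i else - basis i.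
rewrite -(subrK s d) [_ - _ + s]addrC lattD -addrA; apply: gen_charge => [v m|].
  by rewrite /s; case: ifP => _; [apply: U_Sp | apply: U_Sm].
apply: IH => [|j jS]; last first.
  have ji : j != i by apply: contraNneq jS => ->.
  by rewrite /s; case: ifP => _; rewrite !mxE dS //= (negPf ji).
apply: leq_trans dk; rewrite (bigD1 i) //= [X in (_ < X)%N](bigD1 i) //=.
rewrite -addSn leq_add //.
  by rewrite /s; case: ifP; rewrite !mxE !eqxx /=; move: d_i; lia.
apply: leq_sum => j ji.
by rewrite /s; case: ifP => _; rewrite !mxE (negPf ji) /= ?oppr0 subr0.
Qed.

Lemma gen_hprods b (l : seq 'I_n) q : {subset l <= R} -> U (emb b 1) ->
  hprods l q -> U (emb (latt G (\sum_(i <- l) basis i) + b) q).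
Proof.
move=> lR Ub; elim: l q lR => [|i l IH] q lR.
  apply: (@lspan_emb _ _ U sU).
  move=> _ [t tl ->].
  case: t tl => [_|x t tl]; last by discriminate tl.
  by rewrite !big_nil latt0 add0r.
have iR : i \in R by apply: lR; apply: mem_head.
apply: (@lspan_emb _ _ U sU).
move=> _ [t' tl' ->].
case: t' tl' => [tl'|[j a] t [ji tl]]; first by discriminate tl'.
rewrite !big_cons lattD -addrA ji; apply: (gen_hser (H := hprods l)).
- exact: subspace_hprods.
- by move=> c k r; apply: hprods_aexp.
- by move=> v m; apply: U_R.
- by move=> r; apply: IH => k kl; apply: lR; rewrite inE kl orbT.
- by apply: sub_lspan; exists t.
Qed.

Lemma sum_basisE (l : seq 'I_n) j : (\sum_(i <- l) basis i) 0 j = (count_mem j l)%:Z.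
Proof.
elim: l => [|i l IH]; first by rewrite big_nil mxE.
by rewrite big_cons mxE IH /= PoszD mxE eqxx /= natz eq_sym.
Qed.

(** While d_i exceeds the number of factors h_i, the list is padded with i, using h_(i,0) = 1; once
    all multiplicities agree with d, [gen_hprods] applies. *)
Lemma gen_hfil b d (l : seq 'I_n) q : hcap R d l -> (forall i, i \notin R -> d 0 i = 0) ->
  U (emb b 1) -> hprods l q -> U (emb (latt G d + b) q).
Proof.
move=> dl dR Ub; have [k] := ubnP (\sum_i absz (d 0 i - (count_mem i l)%:Z)%R)%N.
elim: k l dl => [l dl k0|k IH l dl]; first by exfalso; move: k0; rewrite ltn0.
rewrite ltnS => dk lq.
have /andP [/allP lR /forall_inP dle] := dl.
have [i d_i|d0] := pickP (fun i => d 0 i != (count_mem i l)%:Z); last first.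
  have -> : d = \sum_(i <- l) basis i.
    by apply/rowP => i; rewrite sum_basisE; apply/eqP/negbFE/d0.
  exact: gen_hprods.
have iR : i \in R.
  apply: contraNT d_i => iR; rewrite dR // eq_sym.
  have : i \notin l by apply: contra iR => /lR.
  by rewrite -has_pred1 has_count -leqNgt leqn0 => /eqP ->.
have lt_i : (count_mem i l)%:Z < d 0 i by rewrite lt_neqAle eq_sym d_i dle.
apply: (IH (i :: l)); last exact: hprods_aug.
  rewrite /hcap /= iR (_ : all _ _ = true) /=; last exact/allP.
  apply/forall_inP => j jR; have := dle j jR.
  by case: eqP => [<-|_] //= le; rewrite PoszD lez1D.
apply: leq_trans dk; rewrite (bigD1 i) //= [X in (_ < X)%N](bigD1 i) //=.
rewrite -addSn leq_add //.
  by rewrite eqxx /=; move: lt_i; move: (count_mem i l) (d 0 i) => x y; lia.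
by apply: leq_sum => j ji; rewrite eq_sym (negPf ji).
Qed.

(** The S-part of the charge is reached before the R-part with its factors h_i, and the creation
    operators of S are applied last. *)
Lemma gen_hmod lam v : U (ee K lam) -> hmod R S (supp2 R S) lam v -> U v.
Proof.
move=> Ulam; apply: lspan_min => // _ [d [r [dRS Hr ->]]]; move: r Hr.
apply: (@lspan_emb _ _ U sU) => _ [l [p [q [ld Sp lq ->]]]] /=; rewrite mulrC; move: p Sp.
apply: (lspan_image (f := [the {linear P -> V} of emb (latt G d + lam) \o mulp q]) (U := U) sU).
move=> _ [t tS ->] /=; rewrite /mulp mulrC; elim: t tS => [_|x t IH /= /andP [xS tS]].
  rewrite big_nil mul1r.
  pose dR : 'rV[int]_n := \row_i if i \in R then d 0 i else 0.
  rewrite -(subrK dR d) [_ - _ + dR]addrC lattD -addrA.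
  apply: (gen_hfil (l := l)) lq.
  - case/andP: ld => lR /forall_inP ld; rewrite /hcap lR /=.
    by apply/forall_inP => i iR; rewrite mxE iR ld.
  - by move=> i iR; rewrite mxE (negPf iR).
  - apply: gen_lattice => // i iS; rewrite !mxE; case: ifP => iR; first exact: subrr.
    by rewrite subr0; apply: dRS; rewrite ?iR.
by rewrite big_cons -mulrA; case: x xS => i k iS; apply: gen_create => //; apply: IH.
Qed.

End Generation.

End Modules.

(** * Supports of vectors in the model *)

Section Support.
Variables (K : fieldType) (n : nat) (G : 'M[int]_n).
Local Notation mon := {cmonom ('I_n * nat)%type}.
Local Notation P := (fockR K ('I_n * nat)%type).
Local Notation V := (VLdual K G).

Definition suppin (Q : mon * dual G -> Prop) : set V :=
  [set v | forall b, b \in msupp v -> Q b].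

Lemma subspace_suppin Q : subspace (suppin Q).
Proof.
split=> [b|c u v Qu Qv b]; first by rewrite msupp0 in_fset0.
move=> /(fsubsetP (msuppD_le _ _)); rewrite in_fsetU => /orP [].
  by move=> /(fsubsetP (msuppZ_le _ _)); apply: Qu.
exact: Qv.
Qed.

Lemma suppin_bvec (Q : mon * dual G -> Prop) m c : Q (m, c) -> suppin Q (bvec K m c).
Proof. by move=> Qmc b; rewrite /bvec msuppU oner_eq0 in_fset1 => /eqP ->. Qed.

Lemma suppin_emb (Q : mon * dual G -> Prop) c (p : P) :
  (forall m, Q (m, c)) -> suppin Q (emb c p).
Proof.
move=> Qc; move: p; apply: (@pspan _ _ P [set p | suppin Q (emb c p)]).
  exact: (subspace_preim [the {linear P -> V} of emb c] (subspace_suppin Q)).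
by move=> t; rewrite /= emb_prod; apply: suppin_bvec.
Qed.

Lemma suppin_emb_symw (Q : mon * dual G -> Prop) c (T : {set 'I_n}) (p : P) :
  (forall m : mon, (forall x, m x != 0%N -> x.1 \in T) -> Q (m, c)) ->
  symw T p -> suppin Q (emb c p).
Proof.
move=> Qc; apply: (lspan_emb (subspace_suppin Q)) => _ [t tT ->].
rewrite emb_prod; apply: suppin_bvec; apply: Qc => x; rewrite mprodE => xt.
by apply: (allP tT); rewrite -has_pred1 has_count lt0n.
Qed.

Lemma suppin_hmod R S D lam (v : V) : hmod R S D lam v ->
  suppin (fun b => exists2 d, D d & b.2 = latt G d + lam) v.
Proof.
apply: lspan_min => [|_ [d [p [Dd _ ->]]]]; first exact: subspace_suppin.
by apply: suppin_emb => m; exists d.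
Qed.

Lemma suppin_hmod0 R D lam (v : V) : hmod R finset.set0 D lam v ->
  suppin (fun b => forall x, b.1 x != 0%N -> x.1 \in R) v.
Proof.
apply: lspan_min => [|_ [d [p [Dd Hp ->]]]]; first exact: subspace_suppin.
by apply: (suppin_emb_symw _ (hfil_symw Hp)).
Qed.

End Support.

(** * Tensor products by extraction of coefficients *)

Section TensorProduct.
Variables (K : fieldType) (n : nat) (G : 'M[int]_n) (S : {set 'I_n}).
Local Notation mon := {cmonom ('I_n * nat)%type}.
Local Notation V := (VLdual K G).
Local Notation fk := (fock K n).

Definition monS (m : mon) : mon := mprod [seq x <- mword m | x.1 \in S].
Definition monC (m : mon) : mon := mprod [seq x <- mword m | x.1 \notin S].

Lemma monSE m x : monS m x = if x.1 \in S then m x else 0%N.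
Proof.
rewrite mprodE count_filter -[in RHS]count_mword; case: ifP => xS.
  by apply: eq_count => y /=; case: eqP => [->|]; rewrite ?xS.
by apply/eqP; rewrite eqn0Ngt -has_count; apply/hasPn => y _ /=; case: eqP => [->|//]; rewrite xS.
Qed.

Lemma monCE m x : monC m x = if x.1 \in S then 0%N else m x.
Proof.
rewrite mprodE count_filter -[in RHS]count_mword; case: ifP => xS; last first.
  by apply: eq_count => y /=; case: eqP => [->|]; rewrite ?xS.
by apply/eqP; rewrite eqn0Ngt -has_count; apply/hasPn => y _ /=; case: eqP => [->|//]; rewrite xS.
Qed.

(* The coefficient in V of the monomial mu in the variables of S. *)
Definition spart (mu : mon) : V -> V :=
  linext (fun b => if monS b.1 == mu then bvec K (monC b.1) b.2 else 0).
HB.instance Definition _ mu :=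
  GRing.isLinear.Build K V V _ (spart mu) (linext_is_linear _).

Definition noS : set V := suppin (fun b => forall x, b.1 x != 0%N -> x.1 \notin S).

Definition varS (m : mon) := forall x, m x != 0%N -> x.1 \in S.

Lemma varS_monS m : varS (monS m).
Proof. by move=> x; rewrite monSE; case: ifP. Qed.

Lemma symS_mon (m : mon) : varS m -> symS S (<< m >> : fk).
Proof. by move=> Sm m'; rewrite msuppU oner_eq0 in_fset1 => /eqP ->. Qed.

Lemma fmul_linear_r (p : fk) : linear (fmul p : V -> V).
Proof. by move=> c u v; rewrite !fmul_toP linearP. Qed.

Lemma fmul_linear_l (v : V) : linear ((@fmul K n G)^~ v).
Proof. exact: linext_is_linear. Qed.

Lemma spart_fmulU mu (m : mon) (v : V) : varS m -> noS v ->
  spart mu (fmul (<< m >> : fk) v) = (m == mu)%:R *: v.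
Proof.
move=> Sm nv.
apply: (@subspace_malg K _ [set v : V | spart mu (fmul (<< m >> : fk) v) = (m == mu)%:R *: v]).
  split=> [|c u w /= Eu Ew] /=.
    by rewrite fmul_toP !linear0 ?scaler0.
  apply: (etrans (congr1 (spart mu) (fmul_linear_r _ _ _ _))).
  apply: (etrans (linext_is_linear _ _ _ _)).
  apply: (etrans (congr2 (fun x y => c *: x + y) Eu Ew)).
  exact: scale_exchange.
move=> b bv /=; rewrite /fmul linextU linextU /spart linextU /=.
have bS := nv b bv.
have -> : monS (mmul m b.1) = m.
  apply/eqP/cmP => x; rewrite monSE cmM; case: ifP => xS.
    have [->|/bS] := eqVneq (b.1 x) 0%N; first by rewrite addn0.
    by rewrite xS.
  by have [->//|/Sm] := eqVneq (m x) 0%N; rewrite xS.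
have -> : monC (mmul m b.1) = b.1.
  apply/eqP/cmP => x; rewrite monCE cmM; case: ifP => xS.
    by have [->//|/bS] := eqVneq (b.1 x) 0%N; rewrite xS.
  by have [->//|/Sm] := eqVneq (m x) 0%N; rewrite xS.
case: eqP => _; last exact: (esym (scale0r _)).
by case: b {bv bS} => b1 b2; apply: (esym (scale1r _)).
Qed.

Lemma spart_fmul mu (p : fk) (v : V) : symS S p -> noS v ->
  spart mu (fmul p v) = p@_mu *: v.
Proof.
move=> Sp nv; rewrite {1}(malg_sumE p).
have -> : fmul (\sum_(b <- msupp p) p@_b *: << b >>) v =
    \sum_(b <- msupp p) p@_b *: fmul (<< b >> : fk) v :> V.
  by rewrite /fmul linear_sum; apply: eq_bigr => b _; rewrite linearZ.
rewrite linear_sum /=.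
rewrite (eq_big_seq (fun b => (p@_b * (b == mu)%:R) *: v)); last first.
  by move=> b bp; rewrite linearZ /= spart_fmulU ?scalerA //; apply: Sp.
rewrite -scaler_suml; congr (_ *: v).
have [mup|muNp] := boolP (mu \in msupp p).
  rewrite (bigD1_seq mu) ?fset_uniq //= eqxx mulr1 big1 ?addr0 // => b /negPf ->.
  by rewrite mulr0.
rewrite mcoeff_outdom // big1_seq // => b /andP [_ bp].
by case: eqP bp muNp => [-> ->|]; rewrite ?mulr0.
Qed.

Lemma linear_on_sum (X Z : lmodType K) (U : set X) (f : X -> Z) (I : eqType)
    (r : seq I) (c : I -> K) (x : I -> X) : subspace U -> linear_on U f ->
  (forall i, i \in r -> U (x i)) ->
  f (\sum_(i <- r) c i *: x i) = \sum_(i <- r) c i *: f (x i).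
Proof.
move=> sU lf; have f0 : f 0 = 0.
  have U0 : U 0 by case: sU.
  by have := lf (-1) 0 0 U0 U0; rewrite scaler0 addr0 scaleN1r addNr.
elim: r => [|i r IH] Ux; first by rewrite !big_nil.
have Ur j : j \in r -> U (x j) by move=> jr; apply: Ux; rewrite inE jr orbT.
rewrite !big_cons lf ?IH //; first by apply: Ux; apply: mem_head.
by apply: subspace_sum_seq => // j jr; apply: subspaceZ => //; apply: Ur.
Qed.

Lemma linear_on0 (X Z : lmodType K) (U : set X) (f : X -> Z) :
  subspace U -> linear_on U f -> f 0 = 0.
Proof.
move=> sU lf; have U0 : U 0 by case: sU.
by have := lf (-1) 0 0 U0 U0; rewrite scaler0 addr0 scaleN1r addNr.
Qed.

Lemma linear_onZ (X Z : lmodType K) (U : set X) (f : X -> Z) c u :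
  subspace U -> linear_on U f -> U u -> f (c *: u) = c *: f u.
Proof.
move=> sU lf Uu; have U0 : U 0 by case: sU.
by have := lf c u 0 Uu U0; rewrite (linear_on0 sU lf) !addr0.
Qed.

(** As N is free of the variables of S, the coefficients [spart mu x] of a vector x in the image lie
    in N and determine it. This forces the factorization x |-> sum_mu f(mu, [spart mu x]). *)
Lemma is_tensor_fmul (N : set V) : subspace N -> N `<=` noS ->
  is_tensor (symS S) N (tens (symS S) N) (@fmul K n G).
Proof.
move=> sN NS; have sS := @subspace_symS K n S.
have sT : subspace (tens (symS S) N) by exact: subspace_lspan.
split=> //.
- split=> [p _ c u v _ _|v _ c p q _ _]; first exact: fmul_linear_r.
  exact: fmul_linear_l.
- by move=> p q Sp Nq; apply: sub_lspan; exists p, q.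
move=> Z f [f1 f2].
pose E (x : V) : {fset mon} := [fset monS b.1 | b in msupp x]%fset.
pose phi (x : V) : Z := \sum_(mu <- E x) f (<< mu >> : fk) (spart mu x).
have part0 mu x : mu \notin E x -> spart mu x = 0.
  move=> muE; rewrite /spart /linext big1_seq // => b /andP [_ bx].
  case: eqP => [e|_]; last by rewrite scaler0.
  by case/negP: muE; apply/imfsetP; exists b.
have partN mu x : tens (symS S) N x -> N (spart mu x).
  apply: (lspan_image (f := [the {linear V -> V} of spart mu])) => // _ [p [w [Sp Nw ->]]].
  by rewrite /= spart_fmul //; [apply: subspaceZ | apply: NS].
have phiE (d : {fset mon}) x : (E x `<=` d)%fset -> {in d, forall mu, varS mu} ->
    phi x = \sum_(mu <- d) f (<< mu >> : fk) (spart mu x).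
  move=> le dS; apply: big_fset_incl => // mu mud muE; rewrite part0 //.
  by apply: (linear_on0 sN); apply: f1; apply: symS_mon; apply: dS.
have ES x : {in E x, forall mu, varS mu}.
  by move=> mu /imfsetP [b _ ->]; apply: varS_monS.
have phi_lin : linear_on (tens (symS S) N) phi.
  move=> c u v Tu Tv; pose d := (E u `|` E v `|` E (c *: u + v)%R)%fset.
  have dS : {in d, forall mu, varS mu}.
    by move=> mu; rewrite !in_fsetU -orbA => /or3P []; apply: ES.
  rewrite !(@phiE d) ?fsubsetUr //; last first.
  - exact: (fsubset_trans (fsubsetUl _ _) (fsubsetUl _ _)).
  - exact: (fsubset_trans (fsubsetUr _ _) (fsubsetUl _ _)).
  rewrite scaler_sumr -big_split; apply: eq_big_seq => mu mud /=.
  by rewrite linearP; apply: f1; [apply/symS_mon/dS | apply: partN | apply: partN].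
have phi_gen p q : symS S p -> N q -> phi (fmul p q) = f p q.
  move=> Sp Nq; pose d := (E (fmul p q) `|` msupp p)%fset.
  have dS : {in d, forall mu, varS mu}.
    by move=> mu; rewrite in_fsetU => /orP [/ES //|mup x]; apply: Sp.
  rewrite (@phiE d) ?fsubsetUl //.
  transitivity (\sum_(mu <- d) p@_mu *: f (<< mu >> : fk) q).
    apply: eq_big_seq => mu mud; rewrite spart_fmul //; last exact: NS.
    by rewrite (linear_onZ _ sN) //; apply: f1; apply/symS_mon/dS.
  rewrite -(linear_on_sum (f := f^~ q) _ sS) //; last 2 first.
  - by move=> x y z; apply: f2.
  - by move=> mu mud; apply/symS_mon/dS.
  congr (f _ q); rewrite [RHS]malg_sumE; apply/esym/big_fset_incl.
    exact: fsubsetUr.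
  by move=> mu _ muN; rewrite mcoeff_outdom // scale0r.
exists phi; split=> // psi psi_lin psi_gen x Tx.
(* Membership in the image is carried along because psi and phi are linear only there. *)
have sub : subspace [set y | tens (symS S) N y /\ psi y = phi y].
  split=> [|c u v [Tu Eu] [Tv Ev]] /=.
    by rewrite (linear_on0 sT psi_lin) (linear_on0 sT phi_lin); case: sT.
  split; first exact: (subspaceP c sT Tu Tv).
  by rewrite (psi_lin _ _ _ Tu Tv) (phi_lin _ _ _ Tu Tv) Eu Ev.
apply: (proj2 (Tx _ sub _)) => _ [p [q [Sp Nq ->]]]; split.
  by apply: sub_lspan; exists p, q.
by rewrite (psi_gen _ _ Sp Nq) (phi_gen _ _ Sp Nq).
Qed.

End TensorProduct.

(** * Identification of the modules and the decomposition *)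

Section Decomposition.
Variables (K : fieldType) (charK0 : [pchar K] =i pred0) (n : nat) (G : 'M[int]_n).
Hypothesis G_sym : G^T = G.
Variable eps : dual G -> dual G -> K.
Hypothesis eps_neq0 : forall a c, eps (latt G a) c != 0.
Hypothesis eps0 : forall c, eps 0 c = 1.
Local Notation P := (fockR K ('I_n * nat)%type).
Local Notation V := (VLdual K G).
Local Notation var i k := (pvar P (i, k%N)).
Implicit Types (R S : {set 'I_n}) (D : set 'rV[int]_n) (lam : dual G).

Lemma supp2_0 R : supp2 R finset.set0 = sublattice R.
Proof.
apply/seteqP; split=> d /= dR i; first by move=> iR; apply: dR; rewrite ?inE.
by move=> iR _; apply: dR.
Qed.

Lemma supp2D R S a d : supp2 R S a -> supp2 R S d -> supp2 R S (d + a).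
Proof. by move=> aRS dRS i iR iS; rewrite mxE aRS // dRS // addr0. Qed.

Lemma hmod_VL R S D : hmod R S D 0 `<=` @VL K n G.
Proof.
by move=> v /suppin_hmod Sv b /Sv [d _ ->]; exists d; rewrite addr0.
Qed.

Lemma hmod_vac R S D lam : D 0 -> hmod R S D lam (ee K lam).
Proof.
move=> D0; rewrite -emb1 -[lam in emb lam]add0r -latt0; apply: hmodI => //.
by apply: hfil1 => i _; rewrite mxE.
Qed.

Lemma hmod_vertex R S D : D `<=` supp2 R S -> D 0 ->
  (forall a d, D a -> D d -> D (d + a)) -> vertex_subalgebra eps (hmod R S D 0 : set V).
Proof.
move=> DRS D0 DD; split; first exact: subspace_hmod.
- exact: hmod_VL.
- exact: hmod_vac.
- by move=> u v m; apply: hmod_Ymode.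
Qed.

(** The model is a vertex subalgebra containing the generators; e^(-sigma) belongs to it since sigma
    lies outside R, so that no capacity is negative. *)
Lemma W_sub R S : disjoint (mem R) (mem S) -> W eps R S `<=` hmod R S (supp2 R S) 0.
Proof.
move=> RS v; apply.
  by apply: hmod_vertex => // [i _ _|a d]; [rewrite mxE | apply: supp2D].
have notR i : i \in S -> i \notin R by move=> iS; rewrite (disjointFl RS).
have lt d : supp2 R S d -> (forall j, j \in R -> 0 <= d 0 j) ->
    hmod R S (supp2 R S) 0 (ee K (latt G d)).
  move=> dRS d0; rewrite -emb1 -[latt G d]addr0; apply: hmodI => //.
  exact: hfil1.
have bas i : i \in R \/ i \in S -> supp2 R S (basis i).
  move=> iRS j jR jS; rewrite mxE /=; case: eqP => // ji.
  by case: iRS; rewrite -ji ?(negPf jR) ?(negPf jS).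
have bas0 i j : 0 <= (basis i) 0 j by rewrite mxE; case: (_ && _).
move=> _ [[i iR ->]|[i iS [|| ] ->]].
- by apply: lt => //; apply: bas; left.
- by apply: lt => //; apply: bas; right.
- apply: lt => [j jR jS|j jR]; first by rewrite mxE bas ?oppr0 //; right.
  rewrite !mxE /=; case: eqP => [ji|_]; last by rewrite oppr0.
  by move: (notR i iS); rewrite -ji jR.
- rewrite bvec_var -[latt G 0]addr0.
  apply: hmodI; first by move=> j _ _; rewrite mxE.
  rewrite -[var i 0]mulr1; apply: hfil_symM.
    by rewrite -[var i 0]mulr1; apply: symw_varM => //; apply: symw1.
  by apply: hfil1 => j _; rewrite mxE.
Qed.

Lemma Wgen_W R S v : Wgen R S v -> W eps R S v.
Proof. by move=> gv U _; apply. Qed.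

(** Only modes of the generators are required to preserve U, so this serves both subalgebras and
    cyclic modules. *)
Lemma hmod_modes (U : set V) R S lam : subspace U ->
    (forall u v m, Wgen R S u -> U v -> U (Ymode eps u m v)) ->
  U (ee K lam) -> hmod R S (supp2 R S) lam `<=` U.
Proof.
move=> sU UY Ulam v; apply: (gen_hmod charK0 G_sym eps_neq0 eps0 sU _ _ _ _ Ulam) => i w m iRS;
  apply: UY.
- by left; exists i.
- by right; exists i => //; constructor 1.
- by right; exists i => //; constructor 2.
- by right; exists i => //; constructor 3.
Qed.

Lemma W_eq R : W eps R finset.set0 = hmod R finset.set0 (sublattice R) 0.
Proof.
rewrite -supp2_0; apply/seteqP; split.
  by apply: W_sub; apply/pred0P => i; rewrite /= inE andbF.
move=> v Hv U [sU _ U0 UU] gU; move: v Hv; apply: hmod_modes => // u v m gu Uv.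
by apply: UU => //; apply: gU.
Qed.

Lemma Wmod_eq R S lam : disjoint (mem R) (mem S) ->
  Wmod eps R S lam = hmod R S (supp2 R S) lam.
Proof.
move=> RS; apply/seteqP; split=> v.
  move=> Wv; apply: (Wv (hmod R S (supp2 R S) lam)); last first.
    by apply: hmod_vac => i _ _; rewrite mxE.
  split; first exact: subspace_hmod.
  move=> u w m /(W_sub RS) Hu Hw; apply: (hmod_Ymode charK0 G_sym eps _ _ _ Hu Hw).
    by [].
  by move=> a d; apply: supp2D.
move=> Hv U [sU UU] Ulam; move: v Hv; apply: hmod_modes => // u v m gu Uv.
by apply: UU => //; apply: Wgen_W.
Qed.

Lemma tens_hmod R S D lam :
  tens (symS S) (hmod R finset.set0 D lam : set V) = hmod R S D lam.
Proof.
apply/seteqP; split.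
  apply: lspan_min => [|_ [p [w [Sp Hw ->]]]]; first exact: subspace_hmod.
  rewrite fmul_toP; move: w Hw.
  apply: (lspan_image (f := [the {linear V -> V} of fmulP (toP p)])).
    exact: subspace_hmod.
  move=> _ [d [q [Dd Hq ->]]]; rewrite [X in hmod _ _ _ _ X](fmulP_emb (toP p) q).
  apply: hmodI => //; apply: hfil_symM; first by apply/symS_toP.
  by apply: hfil_sub Hq => i; rewrite inE.
apply: lspan_min => [|_ [d [r [Dd Hr ->]]]]; first exact: subspace_lspan.
move: r Hr; apply: (@lspan_emb _ _ _ _ _ (tens (symS S) (hmod R finset.set0 D lam))).
  exact: subspace_lspan.
move=> _ [l [p [q [ld Sp lq ->]]]]; apply: sub_lspan.
exists (ofP p), (emb (latt G d + lam) q); split.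
- by apply/symS_toP; rewrite ofPK.
- apply: hmodI => //; rewrite -[q]mul1r; apply: (hfilI ld _ lq); exact: symw1.
- by rewrite fmul_toP ofPK fmulP_emb.
Qed.

(** A charge in [supp2 R S] splits into an R-part and an S-part, and H_d depends only on the
    R-part. *)
Lemma sumspace_hmod R S lam : disjoint (mem R) (mem S) ->
  sumspace (sublattice S)
    (fun d => hmod R finset.set0 (sublattice R) (latt G d + lam) : set V) =
  hmod R finset.set0 (supp2 R S) lam.
Proof.
move=> RS; apply/seteqP; split.
  apply: lspan_min => [|v [d Sd]]; first exact: subspace_hmod.
  apply: lspan_min => [|_ [a [q [Ra Hq ->]]]]; first exact: subspace_hmod.
  rewrite addrA -lattD; apply: hmodI => [i iR iS|].
    by rewrite mxE Ra // Sd // addr0.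
  apply: hfil_eq Hq => i iR; rewrite mxE Sd ?addr0 //.
  by rewrite (disjointFr RS).
apply: lspan_min => [|_ [d [q [dRS Hq ->]]]]; first exact: subspace_lspan.
pose dR : 'rV[int]_n := \row_i if i \in R then d 0 i else 0.
apply: sub_lspan; exists (d - dR).
  move=> i iS; rewrite !mxE; case: ifP => iR; first exact: subrr.
  by rewrite subr0 dRS // iR.
have -> : latt G d + lam = latt G dR + (latt G (d - dR) + lam).
  by rewrite addrA -lattD [dR + _]addrC subrK.
have RdR : sublattice R dR by move=> i iR; rewrite mxE (negPf iR).
have Hq' : hfil R finset.set0 dR q by apply: hfil_eq Hq => i iR; rewrite mxE iR.
exact: (hmodI RdR Hq').
Qed.

(** In a charge a + d + lam with a in L(R), the coordinates on S recover d, so distinct summands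
    have disjoint supports. *)
Lemma direct_sum_hmod R S lam : disjoint (mem R) (mem S) ->
  direct_sum (sublattice S)
    (fun d => hmod R finset.set0 (sublattice R) (latt G d + lam) : set V).
Proof.
move=> RS s w us sN sum0 d ds; apply/malgP => b; rewrite mcoeff0.
apply/eqP; apply: contraT; rewrite mcoeff_neq0 => bd.
have [Sd /suppin_hmod /(_ b bd) [a Ra bE]] := sN d ds.
have other d' : d' \in s -> d' != d -> (w d')@_b = 0.
  move=> d's; apply: contra_neq_eq; rewrite mcoeff_neq0 => bd'.
  have [Sd' /suppin_hmod /(_ b bd') [a' Ra' bE']] := sN d' d's.
  have /latt_inj E : latt G (a + d) = latt G (a' + d').
    by apply: (addIr lam); rewrite !lattD -!addrA -bE.
  apply/rowP => i; have [iS|iNS] := boolP (i \in S); last by rewrite Sd ?Sd'.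
  have iNR : i \notin R by rewrite (disjointFl RS).
  by move/rowP: E => /(_ i); rewrite !mxE Ra // Ra' // !add0r.
move: bd; rewrite -mcoeff_neq0 => /negPf <-.
move/(congr1 (mcoeff b)): sum0; rewrite mcoeff0 raddf_sum (bigD1_seq d) //=.
rewrite big_seq_cond big1 ?addr0 => [->|d' /andP [d's d'd]]; first by rewrite eqxx.
exact: other.
Qed.

Theorem decomposition (R S : {set 'I_n}) (lam : dual G) : disjoint (mem R) (mem S) ->
  let SymS := @symS K n S in
  let WR := W eps R finset.set0 in
  let A := tens SymS WR in
  let N := fun d : 'rV[int]_n => Wmod eps R finset.set0 (latt G d + lam) in
  let D := sublattice S in
  [/\ is_tensor SymS WR A (@fmul K n G) /\ vertex_subalgebra eps A,
      direct_sum D N,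
      forall d, D d ->
        is_tensor SymS (N d) (tens SymS (N d)) (@fmul K n G) /\
        submodule eps A (tens SymS (N d)),
      is_tensor SymS (sumspace D N) (tens SymS (sumspace D N)) (@fmul K n G)
    & module_iso eps A (Wmod eps R S lam) (tens SymS (sumspace D N))].
Proof.
move=> RS SymS WR A N D.
have R0 : disjoint (mem R) (mem (finset.set0 : {set 'I_n})).
  by apply/pred0P => i; rewrite /= inE andbF.
have NE : N = fun d => hmod R finset.set0 (sublattice R) (latt G d + lam).
  by apply/funext => d; rewrite /N Wmod_eq // supp2_0.
have WE : WR = hmod R finset.set0 (sublattice R) 0 by exact: W_eq.
have AE : A = hmod R S (sublattice R) 0.
  exact: (etrans (congr1 (tens SymS) WE) (tens_hmod _ _ _ _)).
have sumE : sumspace D N = hmod R finset.set0 (supp2 R S) lam.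
  exact: (etrans (congr1 (sumspace D) NE) (sumspace_hmod lam RS)).
clearbody A N WR; subst A N WR; rewrite sumE (Wmod_eq lam RS).
have tensE E mu : is_tensor SymS (hmod R finset.set0 E mu : set V)
    (tens SymS (hmod R finset.set0 E mu : set V)) (@fmul K n G).
  apply: is_tensor_fmul; first exact: subspace_hmod.
  move=> v /suppin_hmod0 Sv b /Sv bR x /bR xR.
  by rewrite (disjointFr RS xR).
have RRS : sublattice R `<=` supp2 R S by move=> d dR i iR _; apply: dR.
have RD a d : sublattice R a -> sublattice R d -> sublattice R (d + a).
  by move=> aR dR i iR; rewrite mxE aR // dR // addr0.
have RDS a d : sublattice R a -> supp2 R S d -> supp2 R S (d + a).
  by move=> aR dRS; apply: supp2D => //; apply: RRS.
have sub E mu : (forall a d, sublattice R a -> E d -> E (d + a)) ->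
    submodule eps (hmod R S (sublattice R) 0 : set V) (hmod R S E mu).
  move=> RE; split=> [|u v m Hu Hv]; first exact: subspace_hmod.
  exact: (hmod_Ymode charK0 G_sym eps m RRS RE Hu Hv).
split.
- split; first by have := tensE (sublattice R) 0; rewrite tens_hmod.
  by apply: hmod_vertex => // i _; rewrite mxE.
- exact: direct_sum_hmod.
- by move=> d _; split; [apply: tensE | rewrite tens_hmod; apply: sub].
- exact: tensE.
rewrite tens_hmod; split; [exact: sub | exact: sub |].
(* Both modules have become the same subspace. *)
by exists id; split=> //; split=> // v Hv; exists v.
Qed.

End Decomposition.

Local Close Scope classical_set_scope.
Unset Implicit Arguments.

Theorem theorem2p1 (RR : realType) (n : nat) (G : 'M[int]_n)
    (eps : dual G -> dual G -> CC RR)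
    (R S : {set 'I_n}) (lam : dual G) :
  G^T = G -> nondegenerate_form G -> cocycle eps -> [disjoint R & S] ->
  let SymS := @symS (CC RR) n S in
  let WR := W eps R finset.set0 in
  let A := tens SymS WR in
  let N := fun d : 'rV[int]_n => Wmod eps R finset.set0 (latt G d + lam) in
  let D := sublattice S in
  [/\ (* S(h^(S)_-) (x) W(R) is a vertex subalgebra of V_L *)
      is_tensor SymS WR A (@fmul (CC RR) n G) /\ vertex_subalgebra eps A,
      (* the sum of the W(R; d + lam), d in L(S), is direct *)
      direct_sum D N,
      (* each S(h^(S)_-) (x) W(R; d + lam) is a module for it *)
      forall d, D d ->
        is_tensor SymS (N d) (tens SymS (N d)) (@fmul (CC RR) n G) /\
        submodule eps A (tens SymS (N d)),
      is_tensor SymS (sumspace D N) (tens SymS (sumspace D N)) (@fmul (CC RR) n G)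
    & module_iso eps A (Wmod eps R S lam) (tens SymS (sumspace D N))].
Proof.
move=> G_sym _ [eps_neq0 eps0 _ _ _] RS.
exact: (decomposition (@pchar_num (complex RR)) G_sym eps_neq0 eps0 lam RS).
Qed.
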